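(* Let $a,r,s,K>0$ and $\nu_x,\nu_y\in\mathbb{R}$ with $\nu_x>0$ and $|\nu_x|\ge|\nu_y|$. Consider the system $$\dot x=\nu_x-K\{a(1+r)\sin x+\sin y\},\qquad \dot y=\nu_y-K\{a\sin x+(1+s)\sin y\}$$ on the torus $\mathbb{T}^2=(\mathbb{R}/2\pi\mathbb{Z})^2$. Put $$K_3^{\mathrm{upper}}=\frac{\nu_x}{(1+r)a-1},\qquad K_4=\max\left(\frac{(1+s)\nu_x-\nu_y}{a(r+s+rs)},\ \frac{|\nu_x-(1+r)\nu_y|}{r+s+rs}\right),$$ and let $D=[-\tfrac{\pi}{2},\tfrac{\pi}{2}]\times(-\pi,\pi]\subset\mathbb{T}^2$, with complement $D^{\mathsf c}=\mathbb{T}^2\setminus D$. Suppose $K_3^{\mathrm{upper}}\le K<K_4$. Then the system has stable and unstable periodic orbits in the regions $D$ and $D^{\mathsf c}$, respectively. These periodic orbits have winding numbers zero and one with respect to the $x$ and $y$ directions, respectively. Any other type of periodic orbit does not exist in the entire phase space $\mathbb{T}^2$.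
   Context: The winding numbers of a periodic orbit on $\mathbb{T}^2$ with respect to the $x$ and $y$ directions are the numbers of times the orbit winds around the torus in the $x$ and $y$ directions, respectively, during one period.
   Formalization: The formal theorem adds the assumption (1+r)a > 1, so that K_3^upper is a positive threshold; without it the claim fails (e.g. a=1/2, r=1/10, s=1, ν_x=1, ν_y=0, K=1/10). Winding numbers are counted without sign. *)

(* Defs.v *)
From Stdlib Require Import Reals ZArith.
From Coquelicot Require Import Coquelicot.

Open Scope R_scope.

(* A point of the torus (R / 2 pi Z)^2 is represented by any of its lifts in
   R * R; the sets and relations below are invariant under 2 pi Z^2. *)

Definition torus_eq (p q : R * R) : Prop :=
  exists k l : Z,
    fst p = fst q + 2 * PI * IZR k /\ snd p = snd q + 2 * PI * IZR l.

(* The class of [q] is at distance less than [eps] from the class of [p], for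
   the quotient of the sup metric of R * R. *)
Definition torus_ball (p : R * R) (eps : R) (q : R * R) : Prop :=
  exists q' : R * R, torus_eq q' q /\ ball p eps q'.

Definition vector_field (a r s K nux nuy : R) (p : R * R) : R * R :=
  (nux - K * (a * (1 + r) * sin (fst p) + sin (snd p)),
   nuy - K * (a * sin (fst p) + (1 + s) * sin (snd p))).

(* Lift to the plane of a solution on the torus, defined for all times (the
   fields considered are bounded and Lipschitz). *)
Definition is_solution (F : R * R -> R * R) (z : R -> R * R) : Prop :=
  forall t : R,
    is_derive (fun u => fst (z u)) t (fst (F (z t))) /\
    is_derive (fun u => snd (z u)) t (snd (F (z t))).

Definition is_period (z : R -> R * R) (T : R) : Prop :=
  0 < T /\ forall t : R, torus_eq (z (t + T)) (z t).

(* [T] is the least period. This excludes equilibria, for which every positive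
   number is a period. *)
Definition periodic_orbit (F : R * R -> R * R) (z : R -> R * R) (T : R) : Prop :=
  is_solution F z /\ is_period z T /\ forall T' : R, is_period z T' -> T <= T'.

(* Number of turns made by a lifted angle [u] over [0, T]. It is a count, hence
   unsigned: a periodic orbit may travel in the negative direction. *)
Definition winding_number (u : R -> R) (T : R) (n : nat) : Prop :=
  Rabs (u T - u 0) = 2 * PI * INR n.

Definition winding_numbers (z : R -> R * R) (T : R) (m n : nat) : Prop :=
  winding_number (fun t => fst (z t)) T m /\
  winding_number (fun t => snd (z t)) T n.

Definition orbit_in (A : R * R -> Prop) (z : R -> R * R) : Prop :=
  forall t : R, A (z t).

Definition region_D (p : R * R) : Prop :=
  exists q : R * R, torus_eq q p /\
    (- (PI / 2) <= fst q <= PI / 2) /\ (- PI < snd q <= PI).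

Definition region_Dc (p : R * R) : Prop := ~ region_D p.

(* [p] is at distance less than [eps] from the orbit of [g]. *)
Definition near_orbit (g : R -> R * R) (eps : R) (p : R * R) : Prop :=
  exists u : R, torus_ball (g u) eps p.

Definition lyapunov_stable (F : R * R -> R * R) (g : R -> R * R) : Prop :=
  forall eps : R, 0 < eps -> exists delta : R, 0 < delta /\
    forall z : R -> R * R, is_solution F z -> near_orbit g delta (z 0) ->
    forall t : R, 0 <= t -> near_orbit g eps (z t).

Definition attracting (F : R * R -> R * R) (g : R -> R * R) : Prop :=
  exists delta : R, 0 < delta /\
    forall z : R -> R * R, is_solution F z -> near_orbit g delta (z 0) ->
    forall eps : R, 0 < eps ->
    exists t0 : R, forall t : R, t0 <= t -> near_orbit g eps (z t).

(* Orbital stability: a stable periodic orbit is an asymptotically stable one,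
   an unstable periodic orbit is one that is not even Lyapunov stable. *)
Definition stable_orbit (F : R * R -> R * R) (g : R -> R * R) : Prop :=
  lyapunov_stable F g /\ attracting F g.

Definition unstable_orbit (F : R * R -> R * R) (g : R -> R * R) : Prop :=
  ~ lyapunov_stable F g.

(* A threshold for K > 0: meaningful only if 1 < (1 + r) * a. Otherwise the
   quotient is nonpositive (0 when the denominator vanishes, since / 0 = 0) and
   K3_upper <= K would hold for every K > 0. *)
Definition K3_upper (a r nux : R) : R := nux / ((1 + r) * a - 1).

Definition K4 (a r s nux nuy : R) : R :=
  Rmax (((1 + s) * nux - nuy) / (a * (r + s + r * s)))
       (Rabs (nux - (1 + r) * nuy) / (r + s + r * s)).

(* Main.v *)
(* Write X, Y for the two components of the field. Since
   (cos x)' >= - K a (1 + r) cos^2 x, the strip cos x > 0 is forward invariant,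
   and the time-reversing symmetry (x, y) -> (pi - x, pi - y) makes cos x < 0
   backward invariant, so a periodic orbit stays in one of the two strips. The
   function (1 + r) y - x has derivative Q(y), of constant sign e because there
   is no equilibrium; the corresponding return map of |x| <= pi/2 has a fixed
   point by the intermediate value theorem. On that orbit e Y > 0, so it is a
   graph x = xi(y), and along any solution d = x - xi(y) satisfies
   d' = - (positive) (sin x - sin xi(y)). Hence d decays: every periodic orbit
   in |x| <= pi/2 lies on the graph and is stable, and the symmetry turns this
   into instability in the complement. *)

Require Import Defs.
From Stdlib Require Import Reals.
From Coquelicot Require Import Coquelicot.
From Stdlib Require Import IndefiniteDescription ZArith Lra Lia Psatz Classical.

Open Scope R_scope.

(** The combination (1 + r) y - x is chosen because sin x cancels from (1 + r) Y - X, so the motion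
    across its level lines is governed by y alone; the bound K < K4 enters only through the sign of
    Q. The bound K >= K3_upper is not strict: the field may be tangent to a line cos x = 0, so
    invariance is available for the open strip only. The return map is therefore extended to the
    closed strip by a Lipschitz limit, and a fixed point on the boundary is excluded afterwards,
    because cos x cannot vanish along a whole orbit. Time is then eliminated along the orbit that
    was found, using y as the parameter; compactness of one period gives uniform margins, which turn
    the sign of d' into an exponential rate. The same estimate yields stability and, since d^2 is
    periodic along a periodic orbit, forces d = 0 there. Global solutions with prescribed initial
    point, and their Lipschitz dependence on it, are what the return map and the instability
    argument rest on, so these are built before the system itself. *)

(** * Differential inequalities, geometric limits and primitives *)

Lemma is_derive_continuity_pt (f : R -> R) (x l : R) :
  is_derive f x l -> continuity_pt f x.
Proof.
intros H; apply continuity_pt_filterlim.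
apply ex_derive_continuous with (f := f); now exists l.
Qed.

Lemma derive_mean_value (f df : R -> R) (a b : R) :
  a < b -> (forall t, is_derive f t (df t)) ->
  exists c, a < c < b /\ f b - f a = df c * (b - a).
Proof.
intros Hab Hd.
destruct (MVT_cor2 f df a b Hab) as [c [Hc1 Hc2]].
- intros c _; now apply is_derive_Reals.
- now exists c.
Qed.

Lemma derive_nonneg_le (f df : R -> R) (a b : R) :
  a <= b -> (forall t, is_derive f t (df t)) ->
  (forall t, a < t < b -> 0 <= df t) -> f a <= f b.
Proof.
intros Hab Hd Hp; destruct (Req_dec a b) as [->|Hne]; [lra|].
destruct (derive_mean_value f df a b) as [c [Hc He]]; [lra|assumption|].
specialize (Hp c Hc); nra.
Qed.

(** [t2] is the supremum of the times up to which [f] stays positive; positivity at [t2] would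
    extend past it by continuity. *)
Lemma first_hit (f : R -> R) (t0 t1 : R) :
  (forall t, continuity_pt f t) -> 0 < f t0 -> t0 <= t1 -> f t1 <= 0 ->
  exists t2, t0 < t2 <= t1 /\ f t2 <= 0 /\ forall s, t0 <= s < t2 -> 0 < f s.
Proof.
intros Hc H0 H01 H1.
set (E := fun t => t0 <= t <= t1 /\ forall s, t0 <= s <= t -> 0 < f s).
assert (HE0 : E t0).
{ split; [lra|]; intros s Hs; replace s with t0 by lra; assumption. }
destruct (completeness E) as [t2 [Hub Hlub]].
{ exists t1; intros t [Ht _]; lra. }
{ now exists t0. }
assert (Ht2 : t0 <= t2 <= t1).
{ split; [now apply Hub|]; apply Hlub; intros t [Ht _]; lra. }
assert (Hbelow : forall s, t0 <= s < t2 -> 0 < f s).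
{ intros s Hs; apply NNPP; intros Hn.
  assert (t2 <= s); [|lra].
  apply Hlub; intros t [Ht Hts]; apply Rnot_lt_le; intros Hlt.
  apply Hn, Hts; lra. }
assert (Hf2 : f t2 <= 0).
{ apply Rnot_lt_le; intros Hpos.
  destruct (Hc t2 (f t2) Hpos) as [d [Hd Hcd]].
  assert (Hnear : forall s, Rabs (s - t2) < d -> 0 < f s).
  { intros s Hs; destruct (Req_dec s t2) as [->|Hne]; [assumption|].
    assert (Hdist : Rabs (f s - f t2) < f t2).
    { apply Hcd; split; [split; [exact I|now apply not_eq_sym]|exact Hs]. }
    apply Rabs_def2 in Hdist; lra. }
  destruct (Req_dec t2 t1) as [Heq|Hne]; [rewrite Heq in Hpos; lra|].
  assert (Hm : E (Rmin t1 (t2 + d / 2))).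
  { split.
    - unfold Rmin; destruct (Rle_dec _ _); lra.
    - intros s Hs; destruct (Rlt_le_dec s t2) as [Hlt|Hge].
      + apply Hbelow; lra.
      + apply Hnear; rewrite Rabs_pos_eq by lra.
        assert (Rmin t1 (t2 + d / 2) <= t2 + d / 2) by apply Rmin_r; lra. }
  apply Hub in Hm; unfold Rmin in Hm; destruct (Rle_dec _ _); lra. }
exists t2; repeat split; try lra; try assumption.
destruct (Req_dec t0 t2) as [Heq|Hne]; [rewrite <- Heq in Hf2; lra|lra].
Qed.

(** Up to a first zero, f exp(C t) is nondecreasing, so that zero cannot occur. The inequality is
    asked only where [f] is nonnegative, which permits bootstrap arguments. *)
Lemma positivity_forward (f df : R -> R) (C t0 : R) :
  (forall t, is_derive f t (df t)) ->
  (forall t, t0 <= t -> 0 <= f t -> - C * f t <= df t) ->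
  0 < f t0 -> forall t, t0 <= t -> 0 < f t.
Proof.
intros Hd Hge H0 t1 H01; apply Rnot_le_lt; intros H1.
destruct (first_hit f t0 t1) as [t2 [Ht2 [Hf2 Hpos]]]; try assumption.
{ intros t; now apply is_derive_continuity_pt with (df t). }
assert (Hle : f t0 * exp (C * t0) <= f t2 * exp (C * t2)).
{ apply (derive_nonneg_le (fun t => f t * exp (C * t))
    (fun t => (df t + C * f t) * exp (C * t))); [lra| |].
  - intros t; specialize (Hd t).
    evar_last.
    { apply @is_derive_mult; [exact Hd| |intros; apply Rmult_comm].
      apply (is_derive_comp exp (fun t => C * t)).
      - apply is_derive_exp.
      - apply (is_derive_scal (fun t => t)), @is_derive_id. }
    unfold plus, mult, scal, one; simpl; unfold mult; simpl; ring.
  - intros t Ht; apply Rmult_le_pos; [|left; apply exp_pos].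
    assert (Hp := Hpos t ltac:(lra)).
    specialize (Hge t ltac:(lra) ltac:(lra)); lra. }
assert (H2 := exp_pos (C * t0)); assert (H3 := exp_pos (C * t2)); nra.
Qed.

(** Gronwall's inequality. The sign of [k] is free: a negative [k] bounds exponential growth. *)
Lemma exp_decay (f df : R -> R) (k a b : R) :
  a <= b -> (forall t, is_derive f t (df t)) ->
  (forall t, a <= t -> df t <= - k * f t) ->
  f b <= f a * exp (- k * (b - a)).
Proof.
intros Hab Hd Hle.
assert (H : - (f a * exp (k * a)) <= - (f b * exp (k * b))).
{ apply (derive_nonneg_le (fun t => - (f t * exp (k * t)))
    (fun t => - ((df t + k * f t) * exp (k * t)))); [lra| |].
  - intros t; specialize (Hd t); apply (is_derive_opp (fun t => f t * exp (k * t))).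
    evar_last.
    { apply @is_derive_mult; [exact Hd| |intros; apply Rmult_comm].
      apply (is_derive_comp exp (fun t => k * t)).
      - apply is_derive_exp.
      - apply (is_derive_scal (fun t => t)), @is_derive_id. }
    unfold plus, mult, scal, one; simpl; unfold mult; simpl; ring.
  - intros t Ht; specialize (Hle t ltac:(lra)).
    assert (Hp := exp_pos (k * t)); nra. }
replace (- k * (b - a)) with (k * a + - (k * b)) by ring.
rewrite exp_plus, exp_Ropp.
assert (Hp := exp_pos (k * b)).
apply (Rmult_le_reg_r (exp (k * b))); [assumption|].
replace (f a * (exp (k * a) * / exp (k * b)) * exp (k * b))
  with (f a * exp (k * a)) by (field; lra).
lra.
Qed.

Lemma is_derive_reverse (h : R -> R) (t l : R) :
  is_derive h (- t) l -> is_derive (fun u => h (- u)) t (- l).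
Proof.
intros H; evar_last.
{ apply (is_derive_comp h Ropp); [exact H|].
  instantiate (1 := -1); auto_derive; [exact I|ring]. }
unfold scal; simpl; unfold mult; simpl; ring.
Qed.

(** Integration against the weight exp(k |t|) gains a factor 1 / k. With [k] large this makes the
    Picard operator a contraction on the whole line at once, with no gluing of local solutions. *)
Lemma exp_growth_bound (h dh : R -> R) (c k : R) :
  0 < k -> h 0 = 0 -> (forall t, is_derive h t (dh t)) ->
  (forall t, Rabs (dh t) <= c * exp (k * Rabs t)) ->
  forall t, Rabs (h t) <= c / k * exp (k * Rabs t).
Proof.
intros Hk.
assert (Hpos : forall h dh : R -> R, h 0 = 0 ->
  (forall t, is_derive h t (dh t)) ->
  (forall t, Rabs (dh t) <= c * exp (k * Rabs t)) ->
  forall t, 0 <= t -> h t <= c / k * exp (k * t)).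
{ clear h dh; intros h dh H0 Hd Hb t Ht.
  assert (Hc : 0 <= c).
  { specialize (Hb 0); rewrite Rabs_R0, Rmult_0_r, exp_0 in Hb.
    assert (Hq := Rabs_pos (dh 0)); lra. }
  assert (H : c / k * exp (k * 0) - h 0 <= c / k * exp (k * t) - h t).
  { apply (derive_nonneg_le (fun t => c / k * exp (k * t) - h t)
      (fun t => c * exp (k * t) - dh t)); [lra| |].
    - intros u; apply @is_derive_minus; [|apply Hd].
      evar_last.
      { apply is_derive_scal, (is_derive_comp exp (fun t => k * t)).
        - apply is_derive_exp.
        - apply (is_derive_scal (fun t => t)), @is_derive_id. }
      unfold scal, one; simpl; unfold mult; simpl; field; lra.
    - intros u Hu; specialize (Hb u); rewrite (Rabs_pos_eq u) in Hb by lra.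
      assert (Hq := Rle_abs (dh u)); lra. }
  rewrite H0, Rmult_0_r, exp_0 in H.
  assert (0 <= c / k) by (apply Rdiv_le_0_compat; lra); lra. }
intros H0 Hd Hb.
assert (Habs : forall h dh : R -> R, h 0 = 0 ->
  (forall t, is_derive h t (dh t)) ->
  (forall t, Rabs (dh t) <= c * exp (k * Rabs t)) ->
  forall t, 0 <= t -> Rabs (h t) <= c / k * exp (k * t)).
{ clear h dh H0 Hd Hb; intros h dh H0 Hd Hb t Ht; apply Rabs_le; split.
  - assert (H := Hpos (fun t => - h t) (fun t => - dh t)); simpl in H.
    cut (- h t <= c / k * exp (k * t)); [lra|]; apply H; trivial.
    + rewrite H0; ring.
    + intros u; now apply (is_derive_opp h).
    + intros u; rewrite Rabs_Ropp; apply Hb.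
  - now apply (Hpos h dh). }
intros t; destruct (Rle_lt_dec 0 t) as [Ht|Ht].
- rewrite (Rabs_pos_eq t) by assumption; now apply (Habs h dh).
- rewrite (Rabs_left t) by assumption.
  assert (H := fun H1 H2 H3 =>
    Habs (fun t => h (- t)) (fun t => - dh (- t)) H1 H2 H3 (- t)); cbv beta in H.
  rewrite Ropp_involutive in H; apply H; try lra.
  + rewrite Ropp_0; exact H0.
  + intros u; evar_last.
    { apply is_derive_reverse, Hd. }
    reflexivity.
  + intros u; rewrite Rabs_Ropp, <- (Rabs_Ropp u); apply Hb.
Qed.

(** The intervals of radius 2 c / 2^n around [u n] are nested. The conclusion is a sigma type, so
    that the limit can define a function of time. *)
Lemma geometric_limit (u : nat -> R) (c : R) :
  (forall n, Rabs (u (S n) - u n) <= c * (/ 2) ^ n) ->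
  {l | forall n, Rabs (u n - l) <= 2 * c * (/ 2) ^ n}.
Proof.
intros H.
assert (Hc : 0 <= c).
{ specialize (H 0%nat); simpl in H.
  assert (Hp := Rabs_pos (u 1%nat - u 0%nat)); lra. }
assert (Hmono : forall n k,
  u n - 2 * c * (/ 2) ^ n <= u (n + k)%nat - 2 * c * (/ 2) ^ (n + k) /\
  u (n + k)%nat + 2 * c * (/ 2) ^ (n + k) <= u n + 2 * c * (/ 2) ^ n).
{ intros n k; induction k as [|k IH].
  - rewrite Nat.add_0_r; lra.
  - rewrite Nat.add_succ_r; simpl pow.
    specialize (H (n + k)%nat); apply Rabs_le_between in H; lra. }
assert (Hp : forall n, 0 <= 2 * c * (/ 2) ^ n).
{ intros n; apply Rmult_le_pos; [lra|apply pow_le; lra]. }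
assert (Hab : forall n m, u n - 2 * c * (/ 2) ^ n <= u m + 2 * c * (/ 2) ^ m).
{ intros n m; destruct (Nat.le_ge_cases n m) as [Hle|Hle];
    apply Nat.le_exists_sub in Hle; destruct Hle as [k [-> _]];
    rewrite (Nat.add_comm k).
  - assert (H1 := Hmono n k); assert (H2 := Hp (n + k)%nat); lra.
  - assert (H1 := Hmono m k); assert (H2 := Hp (m + k)%nat); lra. }
destruct (completeness (fun x => exists n, x = u n - 2 * c * (/ 2) ^ n))
  as [l [Hub Hlub]].
- exists (u 0%nat + 2 * c * (/ 2) ^ 0); intros x [n ->]; apply Hab.
- now exists (u 0%nat - 2 * c * (/ 2) ^ 0), 0%nat.
- exists l; intros n; apply Rabs_le; split.
  + assert (l <= u n + 2 * c * (/ 2) ^ n); [|lra].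
    apply Hlub; intros x [m ->]; apply Hab.
  + assert (u n - 2 * c * (/ 2) ^ n <= l); [|lra].
    apply Hub; now exists n.
Qed.

Lemma Rle_0_of_geometric (x c : R) :
  (forall n : nat, x <= c * (/ 2) ^ n) -> x <= 0.
Proof.
intros H; apply Rnot_lt_le; intros Hx.
assert (Hc : 0 < c) by (specialize (H 0%nat); simpl in H; lra).
destruct (pow_lt_1_zero (/ 2)) with (y := x / c) as [N HN].
- rewrite Rabs_pos_eq; lra.
- now apply Rdiv_lt_0_compat.
- specialize (HN N (Nat.le_refl N)); specialize (H N).
  rewrite Rabs_pos_eq in HN by (apply pow_le; lra).
  apply (Rmult_lt_compat_l c) in HN; [|assumption].
  replace (c * (x / c)) with x in HN by (field; lra); lra.
Qed.

Lemma is_derive_Rminus (f g : R -> R) (t l m : R) :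
  is_derive f t l -> is_derive g t m -> is_derive (fun t => f t - g t) t (l - m).
Proof. exact (is_derive_minus f g t l m). Qed.

Lemma is_derive_primitive (g : R -> R) (c t : R) :
  (forall u, continuous g u) -> is_derive (fun t => c + RInt g 0 t) t (g t).
Proof.
intros Hg; evar_last.
{ apply @is_derive_plus; [apply is_derive_const|].
  apply (is_derive_RInt g _ 0 t).
  - apply filter_forall; intros b; apply (@RInt_correct R_CompleteNormedModule).
    apply (@ex_RInt_continuous R_CompleteNormedModule).
    intros u _; apply Hg.
  - apply Hg. }
unfold plus, zero; simpl; ring.
Qed.

Lemma lipschitz_continuous (f : R -> R) (B : R) :
  (forall s t, Rabs (f t - f s) <= B * Rabs (t - s)) ->
  forall t, continuous f t.
Proof.
intros H t; apply continuity_pt_filterlim; intros eps Heps.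
assert (HB : 0 < Rabs B + 1) by (assert (Hp := Rabs_pos B); lra).
exists (eps / (Rabs B + 1)); split; [now apply Rdiv_lt_0_compat|].
intros s [_ Hs]; simpl in *; unfold R_dist in *.
apply Rle_lt_trans with (1 := H t s).
apply Rle_lt_trans with ((Rabs B + 1) * Rabs (s - t)).
- apply Rmult_le_compat_r; [apply Rabs_pos|].
  assert (Hq := Rle_abs B); lra.
- apply (Rmult_lt_compat_l (Rabs B + 1)) in Hs; [|assumption].
  now replace ((Rabs B + 1) * (eps / (Rabs B + 1))) with eps in Hs
    by (field; lra).
Qed.

Lemma bounded_derive_lipschitz (f df : R -> R) (B : R) :
  (forall t, is_derive f t (df t)) -> (forall t, Rabs (df t) <= B) ->
  forall s t, Rabs (f t - f s) <= B * Rabs (t - s).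
Proof.
intros Hd Hb.
assert (H : forall s t, s < t -> Rabs (f t - f s) <= B * Rabs (t - s)).
{ intros s t Hst; destruct (derive_mean_value f df s t Hst Hd) as [c [_ ->]].
  rewrite Rabs_mult; apply Rmult_le_compat_r; [apply Rabs_pos|apply Hb]. }
intros s t; destruct (Rtotal_order s t) as [Hst|[->|Hst]].
- now apply H.
- unfold Rminus; rewrite !Rplus_opp_r, Rabs_R0; lra.
- rewrite (Rabs_minus_sym (f t)), (Rabs_minus_sym t); now apply H.
Qed.

(** * Global solutions of bounded Lipschitz planar systems *)

Section Picard.

Context (f1 f2 : R -> R -> R) (B L x0 y0 : R) (HL : 0 < L).
Context (Hb1 : forall x y, Rabs (f1 x y) <= B)
        (Hb2 : forall x y, Rabs (f2 x y) <= B).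
Context (Hl1 : forall x y x' y',
           Rabs (f1 x y - f1 x' y') <= L * (Rabs (x - x') + Rabs (y - y')))
        (Hl2 : forall x y x' y',
           Rabs (f2 x y - f2 x' y') <= L * (Rabs (x - x') + Rabs (y - y'))).

Fixpoint picard (n : nat) : (R -> R) * (R -> R) :=
  match n with
  | O => (fun _ => x0, fun _ => y0)
  | S n =>
    (fun t => x0 + RInt (fun s => f1 (fst (picard n) s) (snd (picard n) s)) 0 t,
     fun t => y0 + RInt (fun s => f2 (fst (picard n) s) (snd (picard n) s)) 0 t)
  end.

Lemma continuous_lipschitz_comp (f : R -> R -> R) (x y : R -> R) :
  (forall x y x' y',
     Rabs (f x y - f x' y') <= L * (Rabs (x - x') + Rabs (y - y'))) ->
  (forall s t, Rabs (x t - x s) <= B * Rabs (t - s)) ->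
  (forall s t, Rabs (y t - y s) <= B * Rabs (t - s)) ->
  forall t, continuous (fun s => f (x s) (y s)) t.
Proof.
intros Hf Hx Hy; apply lipschitz_continuous with (B := L * (B + B)).
intros s t; apply Rle_trans with (1 := Hf _ _ _ _).
rewrite Rmult_assoc; apply Rmult_le_compat_l; [lra|].
specialize (Hx s t); specialize (Hy s t); lra.
Qed.

Lemma picard_lipschitz n :
  (forall s t, Rabs (fst (picard n) t - fst (picard n) s) <= B * Rabs (t - s)) /\
  (forall s t, Rabs (snd (picard n) t - snd (picard n) s) <= B * Rabs (t - s)).
Proof.
assert (HB : 0 <= B).
{ assert (H1 := Hb1 0 0); assert (H2 := Rabs_pos (f1 0 0)); lra. }
induction n as [|n [IH1 IH2]].
- split; intros s t; simpl; unfold Rminus at 1; rewrite Rplus_opp_r, Rabs_R0;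
    apply Rmult_le_pos; trivial; apply Rabs_pos.
- split; simpl.
  + apply bounded_derive_lipschitz
      with (fun t => f1 (fst (picard n) t) (snd (picard n) t)); trivial.
    intros t; apply (is_derive_primitive
      (fun t => f1 (fst (picard n) t) (snd (picard n) t))).
    now apply continuous_lipschitz_comp.
  + apply bounded_derive_lipschitz
      with (fun t => f2 (fst (picard n) t) (snd (picard n) t)); trivial.
    intros t; apply (is_derive_primitive
      (fun t => f2 (fst (picard n) t) (snd (picard n) t))).
    now apply continuous_lipschitz_comp.
Qed.

Lemma picard_derive n t :
  is_derive (fst (picard (S n))) t (f1 (fst (picard n) t) (snd (picard n) t)) /\
  is_derive (snd (picard (S n))) t (f2 (fst (picard n) t) (snd (picard n) t)).
Proof.
destruct (picard_lipschitz n) as [H1 H2]; split; simpl.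
- apply (is_derive_primitive
    (fun t => f1 (fst (picard n) t) (snd (picard n) t))).
  now apply continuous_lipschitz_comp.
- apply (is_derive_primitive
    (fun t => f2 (fst (picard n) t) (snd (picard n) t))).
  now apply continuous_lipschitz_comp.
Qed.

Lemma picard_0 n : fst (picard n) 0 = x0 /\ snd (picard n) 0 = y0.
Proof.
destruct n as [|n]; simpl; [now split|].
rewrite !RInt_point; unfold zero; simpl; split; ring.
Qed.

(** The weight 4 L comes from two coordinates, each contributing L: a step multiplies the error by 2
    L / (4 L) = 1 / 2. *)
Lemma picard_step n t :
  Rabs (fst (picard (S n)) t - fst (picard n) t)
    <= B / (4 * L) * (/ 2) ^ n * exp (4 * L * Rabs t) /\
  Rabs (snd (picard (S n)) t - snd (picard n) t)
    <= B / (4 * L) * (/ 2) ^ n * exp (4 * L * Rabs t).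
Proof.
revert t; induction n as [|n IH].
- assert (H : forall t, B <= B * exp (4 * L * Rabs t)).
  { intros t; assert (HB : 0 <= B).
    { assert (H1 := Hb1 0 0); assert (H2 := Rabs_pos (f1 0 0)); lra. }
    assert (1 <= exp (4 * L * Rabs t)); [|nra].
    assert (Hp := exp_ineq1_le (4 * L * Rabs t)).
    assert (0 <= 4 * L * Rabs t); [|lra].
    apply Rmult_le_pos; [lra|apply Rabs_pos]. }
  intros t; rewrite pow_O, Rmult_1_r; split.
  + apply (exp_growth_bound
      (fun t => fst (picard 1) t - fst (picard 0) t)
      (fun t => f1 (fst (picard 0) t) (snd (picard 0) t))); [lra| | |].
    * rewrite !(proj1 (picard_0 _)); ring.
    * intros u; rewrite <- (Rminus_0_r (f1 _ _)); apply is_derive_Rminus.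
      -- exact (proj1 (picard_derive 0 u)).
      -- apply (is_derive_const x0).
    * intros u; apply Rle_trans with (2 := H u), Hb1.
  + apply (exp_growth_bound
      (fun t => snd (picard 1) t - snd (picard 0) t)
      (fun t => f2 (fst (picard 0) t) (snd (picard 0) t))); [lra| | |].
    * rewrite !(proj2 (picard_0 _)); ring.
    * intros u; rewrite <- (Rminus_0_r (f2 _ _)); apply is_derive_Rminus.
      -- exact (proj2 (picard_derive 0 u)).
      -- apply (is_derive_const y0).
    * intros u; apply Rle_trans with (2 := H u), Hb2.
- assert (Hbd : forall u,
    L * (Rabs (fst (picard (S n)) u - fst (picard n) u) +
         Rabs (snd (picard (S n)) u - snd (picard n) u))
    <= L * (2 * (B / (4 * L) * (/ 2) ^ n)) * exp (4 * L * Rabs u)).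
  { intros u; rewrite Rmult_assoc; apply Rmult_le_compat_l; [lra|].
    destruct (IH u) as [H1 H2]; lra. }
  intros t.
  replace (B / (4 * L) * (/ 2) ^ S n) with
    (L * (2 * (B / (4 * L) * (/ 2) ^ n)) / (4 * L)) by (simpl; field; lra).
  split.
  + apply (exp_growth_bound
      (fun t => fst (picard (S (S n))) t - fst (picard (S n)) t)
      (fun t => f1 (fst (picard (S n)) t) (snd (picard (S n)) t) -
                f1 (fst (picard n) t) (snd (picard n) t))); [lra| | |].
    * rewrite !(proj1 (picard_0 _)); ring.
    * intros u; apply is_derive_Rminus; apply picard_derive.
    * intros u; apply Rle_trans with (2 := Hbd u), Hl1.
  + apply (exp_growth_bound
      (fun t => snd (picard (S (S n))) t - snd (picard (S n)) t)
      (fun t => f2 (fst (picard (S n)) t) (snd (picard (S n)) t) -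
                f2 (fst (picard n) t) (snd (picard n) t))); [lra| | |].
    * rewrite !(proj2 (picard_0 _)); ring.
    * intros u; apply is_derive_Rminus; apply picard_derive.
    * intros u; apply Rle_trans with (2 := Hbd u), Hl2.
Qed.

(** All iterates share the Lipschitz constant [B], which survives pointwise limits. This is how the
    limit becomes continuous, hence its right-hand side integrable. *)
Lemma lipschitz_limit (u : nat -> R -> R) (v : R -> R) (c : R -> R) :
  (forall n s t, Rabs (u n t - u n s) <= B * Rabs (t - s)) ->
  (forall n t, Rabs (u n t - v t) <= c t * (/ 2) ^ n) ->
  forall s t, Rabs (v t - v s) <= B * Rabs (t - s).
Proof.
intros Hu Hv s t.
assert (Rabs (v t - v s) - B * Rabs (t - s) <= 0); [|lra].
apply Rle_0_of_geometric with (c := c t + c s); intros n.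
specialize (Hu n s t).
assert (H1 := Hv n t); assert (H2 := Hv n s).
assert (Rabs (v t - v s) <= B * Rabs (t - s) + (c t + c s) * (/ 2) ^ n);
  [|lra].
apply Rabs_le_between in Hu; apply Rabs_le_between in H1.
apply Rabs_le_between in H2; apply Rabs_le; lra.
Qed.

Theorem picard_lindelof :
  exists x y : R -> R, x 0 = x0 /\ y 0 = y0 /\
    forall t, is_derive x t (f1 (x t) (y t)) /\ is_derive y t (f2 (x t) (y t)).
Proof.
set (A := B / (4 * L)); set (E := fun t => exp (4 * L * Rabs t)).
assert (Hx : forall t n, Rabs (fst (picard (S n)) t - fst (picard n) t)
                         <= A * E t * (/ 2) ^ n).
{ intros t n; destruct (picard_step n t) as [H _]; unfold A, E; lra. }
assert (Hy : forall t n, Rabs (snd (picard (S n)) t - snd (picard n) t)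
                         <= A * E t * (/ 2) ^ n).
{ intros t n; destruct (picard_step n t) as [_ H]; unfold A, E; lra. }
set (x := fun t => proj1_sig (geometric_limit _ _ (Hx t))).
set (y := fun t => proj1_sig (geometric_limit _ _ (Hy t))).
assert (Hxl : forall n t, Rabs (fst (picard n) t - x t) <=
                          2 * (A * E t) * (/ 2) ^ n).
{ intros n t; apply (proj2_sig (geometric_limit _ _ (Hx t))). }
assert (Hyl : forall n t, Rabs (snd (picard n) t - y t) <=
                          2 * (A * E t) * (/ 2) ^ n).
{ intros n t; apply (proj2_sig (geometric_limit _ _ (Hy t))). }
assert (Hxc : forall s t, Rabs (x t - x s) <= B * Rabs (t - s)).
{ apply lipschitz_limit with (fun n => fst (picard n)) (fun t => 2 * (A * E t));
    trivial; intros n; apply picard_lipschitz. }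
assert (Hyc : forall s t, Rabs (y t - y s) <= B * Rabs (t - s)).
{ apply lipschitz_limit with (fun n => snd (picard n)) (fun t => 2 * (A * E t));
    trivial; intros n; apply picard_lipschitz. }
assert (Hbd : forall n u,
    L * (Rabs (fst (picard n) u - x u) + Rabs (snd (picard n) u - y u))
    <= 4 * L * A * (/ 2) ^ n * exp (4 * L * Rabs u)).
{ intros n u; apply Rle_trans with (L * (4 * (A * E u) * (/ 2) ^ n));
    [|unfold E; lra].
  apply Rmult_le_compat_l; [lra|].
  specialize (Hxl n u); specialize (Hyl n u); lra. }
(* Passage to the limit in the integral equation, stated for an abstract coordinate so as to serve
   both x and y: the next iterate is geometrically close both to [v] and to the integral [G]. *)
assert (Hint : forall (f : R -> R -> R) (c : R) (u : nat -> R -> R) (v : R -> R),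
  (forall x y x' y',
     Rabs (f x y - f x' y') <= L * (Rabs (x - x') + Rabs (y - y'))) ->
  (forall n, u n 0 = c) ->
  (forall n t, is_derive (u (S n)) t (f (fst (picard n) t) (snd (picard n) t))) ->
  (forall n t, Rabs (u n t - v t) <= 2 * (A * E t) * (/ 2) ^ n) ->
  forall t, v t = c + RInt (fun s => f (x s) (y s)) 0 t).
{ intros f c u v Hf H0 Hd Hv t.
  set (G := fun t => c + RInt (fun s => f (x s) (y s)) 0 t).
  assert (HG : forall n, Rabs (u (S n) t - G t) <= A * (/ 2) ^ n * E t).
  { intros n; replace (A * (/ 2) ^ n)
      with (4 * L * A * (/ 2) ^ n / (4 * L)) by (field; lra).
    apply (exp_growth_bound (fun t => u (S n) t - G t)
      (fun t => f (fst (picard n) t) (snd (picard n) t) - f (x t) (y t)));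
      [lra| | |].
    - rewrite H0; unfold G; rewrite RInt_point; unfold zero; simpl; ring.
    - intros w; apply is_derive_Rminus; [apply Hd|].
      apply (is_derive_primitive (fun s => f (x s) (y s))).
      now apply continuous_lipschitz_comp.
    - intros w; apply Rle_trans with (2 := Hbd n w), Hf. }
  assert (Rabs (v t - G t) <= 0).
  { apply Rle_0_of_geometric with (c := 2 * (A * E t)); intros n.
    specialize (HG n); specialize (Hv (S n) t); simpl pow in Hv.
    replace (v t - G t) with (- (u (S n) t - v t) + (u (S n) t - G t)) by ring.
    apply Rle_trans with (1 := Rabs_triang _ _); rewrite Rabs_Ropp; lra. }
  assert (Hz : v t - G t = 0); [|fold (G t); lra].
  apply Rabs_eq_0, Rle_antisym; [assumption|apply Rabs_pos]. }
assert (Hxi : forall t, x t = x0 + RInt (fun s => f1 (x s) (y s)) 0 t).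
{ apply (Hint f1 x0 (fun n => fst (picard n))); trivial.
  - intros n; apply picard_0.
  - intros n t; apply picard_derive. }
assert (Hyi : forall t, y t = y0 + RInt (fun s => f2 (x s) (y s)) 0 t).
{ apply (Hint f2 y0 (fun n => snd (picard n))); trivial.
  - intros n; apply picard_0.
  - intros n t; apply picard_derive. }
exists x, y; split; [|split; [|intros t; split]].
- rewrite Hxi, RInt_point; unfold zero; simpl; ring.
- rewrite Hyi, RInt_point; unfold zero; simpl; ring.
- eapply is_derive_ext; [intros u; symmetry; apply Hxi|].
  apply (is_derive_primitive (fun s => f1 (x s) (y s))).
  now apply continuous_lipschitz_comp.
- eapply is_derive_ext; [intros u; symmetry; apply Hyi|].
  apply (is_derive_primitive (fun s => f2 (x s) (y s))).
  now apply continuous_lipschitz_comp.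
Qed.

End Picard.

(** * Inverse functions, periodic functions and the sine *)

(** A slope of at least [c] makes [g] expand distances by [c]: it is then onto, and its inverse is
    Lipschitz. It serves to replace time by the angle y. *)
Lemma inverse_derive (g dg : R -> R) (c : R) :
  0 < c -> (forall t, is_derive g t (dg t)) -> (forall t, c <= dg t) ->
  exists h, (forall v, g (h v) = v) /\ (forall t, h (g t) = t) /\
    forall v, is_derive h v (/ dg (h v)).
Proof.
intros Hc Hd Hge.
assert (Hmono : forall u v, u <= v -> c * (v - u) <= g v - g u).
{ intros u v [Huv | ->]; [|lra].
  destruct (derive_mean_value g dg u v Huv Hd) as [w [_ ->]].
  apply Rmult_le_compat_r; [lra|apply Hge]. }
assert (Hsurj : forall v, exists t, g t = v).
{ intros v; set (w := Rabs (v - g 0) / c).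
  assert (Hw : 0 <= w) by (apply Rdiv_le_0_compat; [apply Rabs_pos|assumption]).
  assert (Hcw : c * w = Rabs (v - g 0)) by (unfold w; field; lra).
  assert (H1 := Hmono (- w) 0 ltac:(lra)); assert (H2 := Hmono 0 w Hw).
  assert (H3 := Rle_abs (v - g 0)); assert (H4 := Rle_abs (- (v - g 0))).
  rewrite Rabs_Ropp in H4.
  destruct (IVT_gen g (- w) w v) as [t [_ Ht]].
  - intros t; now apply is_derive_continuity_pt with (dg t).
  - rewrite Rmin_left, Rmax_right by lra; lra.
  - now exists t. }
destruct (functional_choice (fun v t => g t = v) Hsurj) as [h Hh].
assert (Hlip : forall u v, c * Rabs (v - u) <= Rabs (g v - g u)).
{ intros u v; destruct (Rle_lt_dec u v) as [Huv|Huv].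
  - specialize (Hmono u v Huv); assert (0 <= c * (v - u)) by nra.
    rewrite !Rabs_pos_eq; lra.
  - specialize (Hmono v u (Rlt_le _ _ Huv)); assert (0 <= c * (u - v)) by nra.
    rewrite (Rabs_minus_sym v), (Rabs_minus_sym (g v)), !Rabs_pos_eq; lra. }
exists h; split; [assumption|]; split.
- intros t; specialize (Hlip t (h (g t))); rewrite Hh in Hlip.
  unfold Rminus in Hlip at 2; rewrite Rplus_opp_r, Rabs_R0 in Hlip.
  apply Rminus_diag_uniq, Rabs_eq_0.
  assert (Hp := Rabs_pos (h (g t) - t)); nra.
- intros v; apply is_derive_Reals; intros eps Heps.
  assert (HD := Hge (h v)).
  (* For a difference quotient q and the slope D, both at least c, |1/q - 1/D| = |q - D| / (q D) <=
     |q - D| / c^2. *)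
  assert (He : 0 < eps * (c * c)) by (apply Rmult_lt_0_compat; nra).
  destruct (proj1 (is_derive_Reals _ _ _) (Hd (h v)) _ He) as [d Hdel].
  assert (Hdc : 0 < d * c) by (apply Rmult_lt_0_compat; [apply cond_pos|lra]).
  exists (mkposreal _ Hdc); simpl; intros k Hk Hkd.
  set (j := h (v + k) - h v).
  assert (Hgj : g (h v + j) - g (h v) = k).
  { unfold j; replace (h v + (h (v + k) - h v)) with (h (v + k)) by ring.
    rewrite !Hh; ring. }
  assert (Hj : j <> 0).
  { intros Hj; rewrite Hj, Rplus_0_r in Hgj; lra. }
  assert (Hjd : Rabs j < d).
  { specialize (Hlip (h v) (h v + j)); rewrite Hgj in Hlip.
    replace (h v + j - h v) with j in Hlip by ring; nra. }
  specialize (Hdel j Hj Hjd); rewrite Hgj in Hdel.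
  assert (Hq : c <= k / j).
  { destruct (Rlt_le_dec 0 j) as [Hj0|Hj0].
    - specialize (Hmono (h v) (h v + j) ltac:(lra)); rewrite Hgj in Hmono.
      apply Rle_div_r; lra.
    - specialize (Hmono (h v + j) (h v) ltac:(lra)).
      replace (k / j) with (- k / - j) by (field; lra).
      apply Rle_div_r; lra. }
  set (q := k / j) in *.
  replace (j / k - / dg (h v)) with
    (- (q - dg (h v)) / (q * dg (h v))).
  2:{ unfold q; field; repeat split; lra. }
  unfold Rdiv; rewrite Rabs_mult, Rabs_Ropp, Rabs_inv.
  rewrite (Rabs_pos_eq (q * dg (h v))) by nra.
  apply (Rmult_lt_reg_r (q * dg (h v))); [nra|].
  rewrite Rmult_assoc, Rinv_l, Rmult_1_r by nra.
  apply Rlt_le_trans with (1 := Hdel).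
  apply Rmult_le_compat_l; [lra|]; apply Rmult_le_compat; lra.
Qed.

Lemma periodic_Z (f : R -> R) (T : R) :
  (forall t, f (t + T) = f t) -> forall (k : Z) t, f (t + IZR k * T) = f t.
Proof.
intros H.
assert (Hn : forall (n : nat) t, f (t + INR n * T) = f t).
{ induction n as [|n IH]; intros t; [f_equal; simpl; ring|].
  rewrite S_INR; replace (t + (INR n + 1) * T) with (t + INR n * T + T) by ring.
  now rewrite H. }
intros k t; destruct (Z.le_ge_cases 0 k) as [Hk|Hk].
- rewrite <- (Z2Nat.id k Hk), <- INR_IZR_INZ; apply Hn.
- rewrite <- (Hn (Z.to_nat (- k)) (t + IZR k * T)), INR_IZR_INZ, Z2Nat.id by lia.
  rewrite opp_IZR; f_equal; ring.
Qed.

Lemma periodic_lower_bound (f : R -> R) (T : R) :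
  0 < T -> (forall t, continuity_pt f t) -> (forall t, f (t + T) = f t) ->
  (forall t, 0 < f t) -> exists c, 0 < c /\ forall t, c <= f t.
Proof.
intros HT Hc Hper Hpos.
destruct (continuity_ab_min f 0 T (Rlt_le _ _ HT)) as [t0 [Hmin _]].
{ intros t _; apply Hc. }
exists (f t0); split; [apply Hpos|]; intros t.
destruct (archimed (- t / T)) as [H1 H2].
(* Adding [up (- t / T)] periods moves [t] into (0, T], where the minimum was taken. *)
rewrite <- (periodic_Z f T Hper (up (- t / T)) t); apply Hmin.
assert (Hq : - t = - t / T * T) by (field; lra).
nra.
Qed.

Lemma is_derive_sin (t : R) : is_derive sin t (cos t).
Proof. auto_derive; [exact I|ring]. Qed.

(** At distance [eta] from the edges of the strip, cos >= sin eta. The product form is symmetric in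
    [u] and [v] and needs no case on their order when it is used. *)
Lemma sin_gap (eta u v : R) :
  0 < eta <= PI / 2 ->
  - (PI / 2) + eta <= u <= PI / 2 - eta ->
  - (PI / 2) + eta <= v <= PI / 2 - eta ->
  sin eta * (u - v) ^ 2 <= (u - v) * (sin u - sin v).
Proof.
intros He.
assert (H : forall u v, - (PI / 2) + eta <= v -> v < u -> u <= PI / 2 - eta ->
  sin eta * (u - v) ^ 2 <= (u - v) * (sin u - sin v)).
{ clear u v; intros u v Hv Hvu Hu.
  destruct (derive_mean_value sin cos v u Hvu) as [w [Hw ->]].
  { exact is_derive_sin. }
  assert (Hcos : sin eta <= cos w).
  { rewrite <- cos_shift; destruct (Rle_lt_dec 0 w) as [Hw0|Hw0].
    - apply cos_decr_1; lra.
    - rewrite <- (cos_neg w); apply cos_decr_1; lra. }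
  assert (0 <= (u - v) ^ 2) by apply pow2_ge_0; nra. }
intros Hu Hv; destruct (Rtotal_order u v) as [Huv|[->|Huv]].
- specialize (H v u ltac:(lra) Huv ltac:(lra)); lra.
- unfold Rminus; rewrite Rplus_opp_r; lra.
- apply H; lra.
Qed.

Lemma sin_cos_shift (x : R) (k : Z) :
  sin (x + 2 * PI * IZR k) = sin x /\ cos (x + 2 * PI * IZR k) = cos x.
Proof.
assert (H : forall (x : R) (n : nat),
  sin (x + 2 * PI * IZR (Z.of_nat n)) = sin x /\
  cos (x + 2 * PI * IZR (Z.of_nat n)) = cos x).
{ clear; intros x n; rewrite <- INR_IZR_INZ.
  replace (x + 2 * PI * INR n) with (x + 2 * INR n * PI) by ring.
  now rewrite sin_period, cos_period. }
destruct (Z.le_ge_cases 0 k) as [Hk|Hk].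
- now rewrite <- (Z2Nat.id k).
- destruct (H (x + 2 * PI * IZR k) (Z.to_nat (- k))) as [H1 H2].
  rewrite Z2Nat.id, opp_IZR in H1, H2 by lia.
  now replace (x + 2 * PI * IZR k + 2 * PI * - IZR k) with x in H1, H2 by ring.
Qed.

Lemma sin_lipschitz (u v : R) : Rabs (sin u - sin v) <= Rabs (u - v).
Proof.
rewrite <- (Rmult_1_l (Rabs (u - v))).
apply (bounded_derive_lipschitz sin cos); [exact is_derive_sin|].
intros t; apply Rabs_le, COS_bound.
Qed.

Lemma exists_INR_gt (x : R) : exists n : nat, x < INR n.
Proof. destruct (INR_unbounded x) as [n Hn]; exists n; lra. Qed.

Lemma exp_nondecreasing (u v : R) : u <= v -> exp u <= exp v.
Proof. intros [H | ->]; [left; now apply exp_increasing|lra]. Qed.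

Ltac rewrite_derive H :=
  match type of H with
  | is_derive ?f ?t ?l => rewrite (is_derive_unique (fun x : R => f x) t l H)
  end.

(** * Invariant strips and the return map *)

Section System.

Context (a r s K nux nuy : R).

Definition X (x y : R) := nux - K * (a * (1 + r) * sin x + sin y).
Definition Y (x y : R) := nuy - K * (a * sin x + (1 + s) * sin y).

(** [sol] and [per] unfold to [is_solution] and [is_period] for the two coordinates, so hypotheses
    pass between the two forms by conversion. *)
Definition sol (x y : R -> R) :=
  forall t, is_derive x t (X (x t) (y t)) /\ is_derive y t (Y (x t) (y t)).

Definition per (x y : R -> R) (T : R) :=
  0 < T /\ forall t, exists k l : Z,
    x (t + T) = x t + 2 * PI * IZR k /\ y (t + T) = y t + 2 * PI * IZR l.

Context (ha : 0 < a) (hr : 0 < r) (hs : 0 < s) (hK : 0 < K).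

Lemma X_bound x y : Rabs (X x y) <= Rabs nux + K * (a * (1 + r) + 1).
Proof.
unfold X; assert (Hx := SIN_bound x); assert (Hy := SIN_bound y).
assert (H := Rle_abs nux); assert (H' := Rle_abs (- nux)).
rewrite Rabs_Ropp in H'.
assert (H1 : 0 < a * (1 + r)) by nra.
assert (Rabs (a * (1 + r) * sin x + sin y) <= a * (1 + r) + 1).
{ apply Rabs_le; nra. }
apply Rabs_le_between in H0; apply Rabs_le; nra.
Qed.

Lemma Y_bound x y : Rabs (Y x y) <= Rabs nuy + K * (a + (1 + s)).
Proof.
unfold Y; assert (Hx := SIN_bound x); assert (Hy := SIN_bound y).
assert (H := Rle_abs nuy); assert (H' := Rle_abs (- nuy)).
rewrite Rabs_Ropp in H'.
assert (Rabs (a * sin x + (1 + s) * sin y) <= a + (1 + s)).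
{ apply Rabs_le; nra. }
apply Rabs_le_between in H0; apply Rabs_le; nra.
Qed.

Lemma linear_lipschitz (c d x y x' y' : R) : 0 < c -> 0 < d ->
  Rabs (K * (c * sin x + d * sin y) - K * (c * sin x' + d * sin y'))
    <= K * (c * Rabs (x - x') + d * Rabs (y - y')).
Proof.
intros Hc Hd.
replace (K * (c * sin x + d * sin y) - K * (c * sin x' + d * sin y'))
  with (K * (c * (sin x - sin x') + d * (sin y - sin y'))) by ring.
rewrite Rabs_mult, (Rabs_pos_eq K) by lra.
apply Rmult_le_compat_l; [lra|].
apply Rle_trans with (1 := Rabs_triang _ _).
rewrite !Rabs_mult, (Rabs_pos_eq c), (Rabs_pos_eq d) by lra.
assert (H1 := sin_lipschitz x x'); assert (H2 := sin_lipschitz y y'); nra.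
Qed.

Lemma X_lipschitz x y x' y' :
  Rabs (X x y - X x' y') <= K * (a * (1 + r) * Rabs (x - x') + Rabs (y - y')).
Proof.
assert (H := linear_lipschitz (a * (1 + r)) 1 x' y' x y ltac:(nra) ltac:(lra)).
rewrite (Rabs_minus_sym x), (Rabs_minus_sym y); unfold X.
rewrite !Rmult_1_l in H.
now replace (nux - K * (a * (1 + r) * sin x + sin y) -
         (nux - K * (a * (1 + r) * sin x' + sin y'))) with
  (K * (a * (1 + r) * sin x' + sin y') -
   K * (a * (1 + r) * sin x + sin y)) by ring.
Qed.

Lemma Y_lipschitz x y x' y' :
  Rabs (Y x y - Y x' y') <= K * (a * Rabs (x - x') + (1 + s) * Rabs (y - y')).
Proof.
assert (H := linear_lipschitz a (1 + s) x' y' x y ltac:(nra) ltac:(lra)).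
rewrite (Rabs_minus_sym x), (Rabs_minus_sym y); unfold Y.
now replace (nuy - K * (a * sin x + (1 + s) * sin y) -
         (nuy - K * (a * sin x' + (1 + s) * sin y'))) with
  (K * (a * sin x' + (1 + s) * sin y') -
   K * (a * sin x + (1 + s) * sin y)) by ring.
Qed.

Lemma sol_exists x0 y0 : exists x y, sol x y /\ x 0 = x0 /\ y 0 = y0.
Proof.
destruct (picard_lindelof X Y
  ((Rabs nux + K * (a * (1 + r) + 1)) + (Rabs nuy + K * (a + (1 + s))))
  (K * (a * (1 + r) + a + (2 + s))) x0 y0) as [x [y [Hx [Hy Hd]]]].
- apply Rmult_lt_0_compat; nra.
- intros x y; assert (H1 := X_bound x y); assert (H2 := Y_bound x y).
  assert (H3 := Rabs_pos (Y x y)); lra.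
- intros x y; assert (H1 := X_bound x y); assert (H2 := Y_bound x y).
  assert (H3 := Rabs_pos (X x y)); lra.
- intros x y x' y'; apply Rle_trans with (1 := X_lipschitz _ _ _ _).
  rewrite (Rmult_assoc K); apply Rmult_le_compat_l; [lra|].
  assert (H1 := Rabs_pos (x - x')); assert (H2 := Rabs_pos (y - y')).
  assert (0 < a * (1 + r)) by nra; nra.
- intros x y x' y'; apply Rle_trans with (1 := Y_lipschitz _ _ _ _).
  rewrite (Rmult_assoc K); apply Rmult_le_compat_l; [lra|].
  assert (H1 := Rabs_pos (x - x')); assert (H2 := Rabs_pos (y - y')).
  assert (0 < a * (1 + r)) by nra; nra.
- now exists x, y.
Qed.

Lemma sol_shift x y c :
  sol x y -> sol (fun t => x (t + c)) (fun t => y (t + c)).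
Proof.
intros H t; destruct (H (t + c)) as [Hx Hy]; split.
- evar_last; [apply (is_derive_comp x (fun t => t + c)); [exact Hx|]|].
  + instantiate (1 := 1); auto_derive; [exact I|ring].
  + unfold scal; simpl; unfold mult; simpl; ring.
- evar_last; [apply (is_derive_comp y (fun t => t + c)); [exact Hy|]|].
  + instantiate (1 := 1); auto_derive; [exact I|ring].
  + unfold scal; simpl; unfold mult; simpl; ring.
Qed.

Lemma field_torus x y (k l : Z) :
  X (x + 2 * PI * IZR k) (y + 2 * PI * IZR l) = X x y /\
  Y (x + 2 * PI * IZR k) (y + 2 * PI * IZR l) = Y x y.
Proof.
unfold X, Y; now rewrite !(proj1 (sin_cos_shift _ _)).
Qed.

Lemma sol_torus x y (k l : Z) :
  sol x y -> sol (fun t => x t + 2 * PI * IZR k) (fun t => y t + 2 * PI * IZR l).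
Proof.
intros H t; destruct (H t) as [Hx Hy].
destruct (field_torus (x t) (y t) k l) as [-> ->].
split; rewrite <- (Rplus_0_r (_ (x t) (y t))).
- apply (is_derive_plus x); [exact Hx|]; apply (is_derive_const (2 * PI * IZR k)).
- apply (is_derive_plus y); [exact Hy|]; apply (is_derive_const (2 * PI * IZR l)).
Qed.

(* The map (x, y) -> (pi - x, pi - y) reverses time and exchanges the strips
   cos x > 0 and cos x < 0. *)
Lemma sol_reflect x y :
  sol x y -> sol (fun t => PI - x (- t)) (fun t => PI - y (- t)).
Proof.
intros H t; destruct (H (- t)) as [Hx Hy].
assert (HX : X (PI - x (- t)) (PI - y (- t)) = 0 - - X (x (- t)) (y (- t))).
{ unfold X; rewrite !sin_PI_x; ring. }
assert (HY : Y (PI - x (- t)) (PI - y (- t)) = 0 - - Y (x (- t)) (y (- t))).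
{ unfold Y; rewrite !sin_PI_x; ring. }
rewrite HX, HY; split; apply is_derive_Rminus; try apply (is_derive_const PI);
  now apply is_derive_reverse.
Qed.

Lemma per_reflect x y T :
  per x y T -> per (fun t => PI - x (- t)) (fun t => PI - y (- t)) T.
Proof.
intros [HT H]; split; [assumption|]; intros t.
destruct (H (- (t + T))) as [k [l Hkl]]; exists k, l.
replace (- (t + T) + T) with (- t) in Hkl by ring.
destruct Hkl as [-> ->]; split; ring.
Qed.

(** Twice the sum of the Lipschitz coefficients of X and Y: a bound for the logarithmic derivative
    of the squared distance of two solutions. *)
Definition growth := 2 * K * (a * (1 + r) + a + (2 + s)).

Lemma growth_pos : 0 < growth.
Proof. unfold growth; apply Rmult_lt_0_compat; nra. Qed.

(** Gronwall on the squared distance, in both directions of time; it provides uniqueness and the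
    dependence on initial data that the return map needs. *)
Lemma sol_distance x1 y1 x2 y2 t0 t :
  sol x1 y1 -> sol x2 y2 ->
  (x1 t - x2 t) ^ 2 + (y1 t - y2 t) ^ 2 <=
  ((x1 t0 - x2 t0) ^ 2 + (y1 t0 - y2 t0) ^ 2) * exp (growth * Rabs (t - t0)).
Proof.
intros H1 H2.
set (N := fun t => (x1 t - x2 t) ^ 2 + (y1 t - y2 t) ^ 2).
set (dN := fun t =>
  2 * (x1 t - x2 t) * (X (x1 t) (y1 t) - X (x2 t) (y2 t)) +
  2 * (y1 t - y2 t) * (Y (x1 t) (y1 t) - Y (x2 t) (y2 t))).
assert (Hd : forall t, is_derive N t (dN t)).
{ intros u; destruct (H1 u) as [Hx1 Hy1]; destruct (H2 u) as [Hx2 Hy2].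
  unfold N, dN; auto_derive.
  - repeat split; eexists; eassumption.
  - rewrite_derive Hx1; rewrite_derive Hx2.
    rewrite_derive Hy1; rewrite_derive Hy2; ring. }
assert (Hb : forall t, Rabs (dN t) <= growth * N t).
{ intros u; unfold dN, N, growth.
  assert (HX := X_lipschitz (x1 u) (y1 u) (x2 u) (y2 u)).
  assert (HY := Y_lipschitz (x1 u) (y1 u) (x2 u) (y2 u)).
  rewrite <- (pow2_abs (x1 u - x2 u)), <- (pow2_abs (y1 u - y2 u)).
  apply Rle_trans with (1 := Rabs_triang _ _).
  rewrite !Rabs_mult, (Rabs_pos_eq 2) by lra.
  assert (Hp := Rabs_pos (x1 u - x2 u)); assert (Hq := Rabs_pos (y1 u - y2 u)).
  revert HX HY Hp Hq.
  generalize (Rabs (x1 u - x2 u)) (Rabs (y1 u - y2 u))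
    (Rabs (X (x1 u) (y1 u) - X (x2 u) (y2 u)))
    (Rabs (Y (x1 u) (y1 u) - Y (x2 u) (y2 u))).
  intros p q P Q HP HQ Hp Hq.
  assert (p * P <= p * (K * (a * (1 + r) * p + q)))
    by (apply Rmult_le_compat_l; lra).
  assert (q * Q <= q * (K * (a * p + (1 + s) * q)))
    by (apply Rmult_le_compat_l; lra).
  (* The slack between growth (p^2 + q^2) and the bound for the derivative, written as a sum of
     squares. *)
  assert (0 <= K * ((1 + a) * ((p - q) ^ 2 + p ^ 2 + q ^ 2)
    + 2 * a * (1 + r) * q ^ 2 + 2 * (1 + s) * p ^ 2)).
  { apply Rmult_le_pos; [lra|].
    assert (0 <= p ^ 2) by apply pow2_ge_0.
    assert (0 <= q ^ 2) by apply pow2_ge_0.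
    assert (0 <= (p - q) ^ 2) by apply pow2_ge_0.
    assert (0 < a * (1 + r)) by nra.
    assert (0 <= (1 + a) * ((p - q) ^ 2 + p ^ 2 + q ^ 2))
      by (apply Rmult_le_pos; lra).
    assert (0 <= a * (1 + r) * q ^ 2) by (apply Rmult_le_pos; lra).
    assert (0 <= (1 + s) * p ^ 2) by (apply Rmult_le_pos; lra).
    lra. }
  lra. }
change (N t <= N t0 * exp (growth * Rabs (t - t0))).
destruct (Rle_lt_dec t0 t) as [Ht|Ht].
- rewrite Rabs_pos_eq by lra.
  replace (growth * (t - t0)) with (- - growth * (t - t0)) by ring.
  apply exp_decay with dN; trivial; intros u _.
  specialize (Hb u); apply Rabs_le_between in Hb; lra.
- rewrite Rabs_left by lra.
  replace (growth * - (t - t0)) with (- - growth * (- t - - t0)) by ring.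
  assert (HN := exp_decay (fun u => N (- u)) (fun u => - dN (- u)) (- growth)
    (- t0) (- t)); cbv beta in HN; rewrite !Ropp_involutive in HN.
  rewrite Ropp_involutive; apply HN; [lra| |].
  + intros u; apply is_derive_reverse, Hd.
  + intros u _; specialize (Hb (- u)); apply Rabs_le_between in Hb; lra.
Qed.

Lemma sol_unique x1 y1 x2 y2 t0 :
  sol x1 y1 -> sol x2 y2 -> x1 t0 = x2 t0 -> y1 t0 = y2 t0 ->
  forall t, x1 t = x2 t /\ y1 t = y2 t.
Proof.
intros H1 H2 Hx Hy t.
assert (H := sol_distance x1 y1 x2 y2 t0 t H1 H2).
rewrite Hx, Hy in H.
replace ((x2 t0 - x2 t0) ^ 2 + (y2 t0 - y2 t0) ^ 2) with 0 in H by ring.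
rewrite Rmult_0_l in H.
assert (Hp := pow2_ge_0 (x1 t - x2 t)); assert (Hq := pow2_ge_0 (y1 t - y2 t)).
assert (Hx0 : (x1 t - x2 t) ^ 2 = 0) by lra.
assert (Hy0 : (y1 t - y2 t) ^ 2 = 0) by lra.
rewrite <- Rsqr_pow2 in Hx0; apply Rsqr_0_uniq in Hx0.
rewrite <- Rsqr_pow2 in Hy0; apply Rsqr_0_uniq in Hy0.
lra.
Qed.

Context (hnux : 0 < nux) (hlow : nux <= K * ((1 + r) * a - 1)).

(** With S = K a (1 + r), [hlow] reads S >= nux + K, hence sin x (nux - K sin y) <= S = S sin^2 x +
    S cos^2 x. As cos^2 x <= cos x where cos x >= 0, the inequality becomes linear. *)
Lemma cos_forward x y t0 :
  sol x y -> 0 < cos (x t0) -> forall t, t0 <= t -> 0 < cos (x t).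
Proof.
intros H; apply (positivity_forward (fun t => cos (x t))
  (fun t => - sin (x t) * X (x t) (y t)) (K * a * (1 + r))).
- intros t; destruct (H t) as [Hx _]; auto_derive.
  + now eexists; eassumption.
  + rewrite_derive Hx; ring.
- intros t _ Hc.
  assert (Hs := SIN_bound (x t)); assert (Hy := SIN_bound (y t)).
  assert (Hc1 := COS_bound (x t)).
  assert (Hsq := sin2_cos2 (x t)); unfold Rsqr in Hsq.
  set (S := K * a * (1 + r)).
  assert (HS : nux + K <= S) by (unfold S; lra).
  assert (Hb : sin (x t) * (nux - K * sin (y t)) <= S).
  { assert (Hz : Rabs (nux - K * sin (y t)) <= S) by (apply Rabs_le; nra).
    apply Rabs_le_between in Hz; nra. }
  assert (cos (x t) * cos (x t) <= cos (x t)) by nra.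
  assert (HX : sin (x t) * X (x t) (y t) =
    sin (x t) * (nux - K * sin (y t)) - S * (sin (x t) * sin (x t)))
    by (unfold X, S; ring).
  nra.
Qed.

Lemma per_iter x y T (n : nat) t :
  per x y T -> exists k l : Z,
    x (t + INR n * T) = x t + 2 * PI * IZR k /\
    y (t + INR n * T) = y t + 2 * PI * IZR l.
Proof.
intros [HT H]; induction n as [|n [k [l [IHx IHy]]]].
- exists 0%Z, 0%Z; simpl; rewrite Rmult_0_l, !Rplus_0_r; split; ring.
- destruct (H (t + INR n * T)) as [k' [l' [Hx Hy]]].
  exists (k + k')%Z, (l + l')%Z; rewrite S_INR, !plus_IZR.
  replace (t + (INR n + 1) * T) with (t + INR n * T + T) by ring.
  rewrite Hx, Hy, IHx, IHy; split; ring.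
Qed.

(** Forward invariance reaches earlier times as well: enough periods added to [t] carry it past
    [t0]. *)
Lemma cos_pos_per x y T t0 :
  sol x y -> per x y T -> 0 < cos (x t0) -> forall t, 0 < cos (x t).
Proof.
intros H Hper H0 t; destruct (exists_INR_gt ((t0 - t) / T)) as [n Hn].
destruct (per_iter x y T n t Hper) as [k [l [Hx _]]].
rewrite <- (proj2 (sin_cos_shift (x t) k)), <- Hx.
apply (cos_forward x y t0); trivial.
destruct Hper as [HT _]; apply (Rmult_lt_compat_r T) in Hn; [|assumption].
unfold Rdiv in Hn; rewrite Rmult_assoc, Rinv_l in Hn by lra; lra.
Qed.

(* (1 + r) y - x moves at the rate Q, which depends on y alone and has no zero
   when there is no equilibrium. *)
Definition Q (y : R) := (1 + r) * nuy - nux - K * (r + s + r * s) * sin y.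

Lemma X_Q x y : X x y = (1 + r) * Y x y - Q y.
Proof. unfold X, Y, Q; ring. Qed.

Context (hQ : forall y, Q y <> 0).

Lemma is_derive_eq_const (f : R -> R) (t l c : R) :
  is_derive f t l -> (forall u, f u = c) -> l = 0.
Proof.
intros H Hc; rewrite <- (is_derive_unique _ _ _ H).
rewrite (Derive_ext f (fun _ => c)) by exact Hc; apply Derive_const.
Qed.

(* If cos x vanishes identically then X = 0 along the solution; differentiating
   this twice forces Y = 0 as well, hence Q = 0 there. *)
Lemma cos_zero_absurd x y : sol x y -> ~ (forall t, cos (x t) = 0).
Proof.
intros H Hc.
assert (HX : forall t, X (x t) (y t) = 0).
{ intros t; destruct (H t) as [Hx _].
  assert (Hd : is_derive (fun t => cos (x t)) t (- sin (x t) * X (x t) (y t))).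
  { auto_derive; [now eexists; eassumption|].
    rewrite_derive Hx; ring. }
  assert (He := is_derive_eq_const _ _ _ _ Hd Hc).
  assert (Hsq := sin2_cos2 (x t)); rewrite Hc in Hsq; unfold Rsqr in Hsq.
  destruct (Rmult_integral _ _ He); nra. }
assert (HY : forall t, Y (x t) (y t) <> 0).
{ intros t H0; apply (hQ (y t)); assert (H1 := X_Q (x t) (y t)).
  rewrite HX, H0 in H1; lra. }
assert (Hcy : forall t, cos (y t) = 0).
{ intros t; destruct (H t) as [Hx Hy].
  assert (Hd : is_derive (fun t => X (x t) (y t)) t
    (- K * (a * (1 + r) * cos (x t) * X (x t) (y t)
            + cos (y t) * Y (x t) (y t)))).
  { unfold X at 1; auto_derive; [repeat split; eexists; eassumption|].
    rewrite_derive Hx; rewrite_derive Hy; ring. }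
  assert (He := is_derive_eq_const _ _ _ _ Hd HX).
  rewrite Hc, HX in He; specialize (HY t).
  assert (He' : K * (cos (y t) * Y (x t) (y t)) = 0) by lra.
  apply Rmult_integral in He'; destruct He' as [He'|He']; [lra|].
  apply Rmult_integral in He'; tauto. }
destruct (H 0) as [_ Hy].
assert (Hd : is_derive (fun t => cos (y t)) 0 (- sin (y 0) * Y (x 0) (y 0))).
{ auto_derive; [now eexists; eassumption|].
  rewrite_derive Hy; ring. }
assert (He := is_derive_eq_const _ _ _ _ Hd Hcy).
assert (Hsq := sin2_cos2 (y 0)); rewrite Hcy in Hsq; unfold Rsqr in Hsq.
specialize (HY 0); destruct (Rmult_integral _ _ He); [nra|tauto].
Qed.

(** Either sign, once attained, spreads to all times, the negative one through the reflection; what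
    remains is cos x identically zero. *)
Lemma cos_sign_per x y T :
  sol x y -> per x y T ->
  (forall t, 0 < cos (x t)) \/ (forall t, cos (x t) < 0).
Proof.
intros H Hper.
destruct (classic (exists t, 0 < cos (x t))) as [[t0 H0]|Hpos].
{ left; now apply (cos_pos_per x y T t0). }
destruct (classic (exists t, cos (x t) < 0)) as [[t0 H0]|Hneg].
- right; intros t.
  assert (Hr : 0 < cos (PI - x (- - t))); [|rewrite Ropp_involutive,
    Rtrigo_facts.cos_pi_minus in Hr; lra].
  apply (cos_pos_per (fun t => PI - x (- t)) (fun t => PI - y (- t)) T (- t0)).
  + now apply sol_reflect.
  + now apply per_reflect.
  + rewrite Ropp_involutive, Rtrigo_facts.cos_pi_minus; lra.
- exfalso; apply (cos_zero_absurd x y H); intros t.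
  apply Rle_antisym; apply Rnot_lt_le; intros Hlt.
  + apply Hpos; now exists t.
  + apply Hneg; now exists t.
Qed.

(* e is the direction in which y winds. *)
Context (e m : R) (he : e = 1 \/ e = -1) (hm : 0 < m)
        (hQm : forall y, m <= e * Q y).

(** The sign of the cosine determines the strip only modulo 2 pi; continuity of the lift keeps it
    between the same two zeros. *)
Lemma strip_connected (x : R -> R) t0 t :
  (forall t, continuity_pt x t) ->
  (forall u, Rmin t0 t <= u <= Rmax t0 t -> 0 < cos (x u)) ->
  - (PI / 2) < x t0 < PI / 2 -> - (PI / 2) < x t < PI / 2.
Proof.
intros Hc Hp H0.
assert (Hno : forall v, cos v = 0 -> ~ Rmin (x t0) (x t) <= v <= Rmax (x t0) (x t)).
{ intros v Hv Hb; destruct (IVT_gen x t0 t v Hc Hb) as [u [Hu Hxu]].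
  specialize (Hp u Hu); rewrite Hxu in Hp; lra. }
assert (H1 := Hno (PI / 2) cos_PI2).
assert (H2 := Hno (- (PI / 2))); rewrite cos_neg in H2; specialize (H2 cos_PI2).
unfold Rmin, Rmax in H1, H2.
destruct (Rle_dec (x t0) (x t)); split; apply Rnot_le_lt; intros Hn;
  lra.
Qed.

Lemma angle_reduce (u : R) : exists k : Z,
  - PI < u + 2 * PI * IZR k <= PI.
Proof.
assert (HP := PI_RGT_0).
destruct (archimed (- (u + PI) / (2 * PI))) as [H1 H2].
exists (up (- (u + PI) / (2 * PI))).
assert (Hq : - (u + PI) = - (u + PI) / (2 * PI) * (2 * PI)) by (field; lra).
nra.
Qed.

Lemma cos_pos_strip (u : R) :
  0 < cos u -> exists k : Z, - (PI / 2) < u + 2 * PI * IZR k < PI / 2.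
Proof.
intros Hu; destruct (angle_reduce u) as [k Hk]; exists k.
rewrite <- (proj2 (sin_cos_shift u k)) in Hu.
set (v := u + 2 * PI * IZR k) in *.
split; apply Rnot_le_lt; intros Hv.
- rewrite <- cos_neg in Hu; assert (H := cos_le_0 (- v)); lra.
- assert (H := cos_le_0 v); lra.
Qed.

Lemma sol_continuity x y : sol x y ->
  (forall t, continuity_pt x t) /\ (forall t, continuity_pt y t).
Proof.
intros H; split; intros t; destruct (H t) as [Hx Hy];
  eapply is_derive_continuity_pt; eassumption.
Qed.

(* On Y = 0 one has e Y' = K a cos x (e Q), so within the strip e Y can only
   change sign from negative to positive. *)
Lemma Y_pos_forward x y t0 :
  sol x y -> (forall t, t0 <= t -> 0 <= cos (x t)) ->
  0 < e * Y (x t0) (y t0) -> forall t, t0 <= t -> 0 < e * Y (x t) (y t).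
Proof.
intros H Hc; apply (positivity_forward (fun t => e * Y (x t) (y t))
  (fun t => - e * K * (a * cos (x t) * X (x t) (y t)
                       + (1 + s) * cos (y t) * Y (x t) (y t)))
  (K * (a * (1 + r) + (1 + s)))).
- intros t; destruct (H t) as [Hx Hy]; unfold Y at 1; auto_derive.
  + repeat split; eexists; eassumption.
  + rewrite_derive Hx; rewrite_derive Hy; ring.
- intros t Ht HY; specialize (Hc t Ht); rewrite X_Q.
  specialize (hQm (y t)); set (G := e * Y (x t) (y t)) in *.
  assert (Hcx := COS_bound (x t)); assert (Hcy := COS_bound (y t)).
  (* Eliminating X isolates the favourable term in e Q; the rest is [G] times a bounded factor. *)
  replace (- e * K * (a * cos (x t) * ((1 + r) * Y (x t) (y t) - Q (y t))
    + (1 + s) * cos (y t) * Y (x t) (y t))) with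
    (K * (a * cos (x t) * (e * Q (y t)))
     - K * ((a * (1 + r) * cos (x t) + (1 + s) * cos (y t)) * G))
    by (unfold G; ring).
  assert (0 <= K * (a * cos (x t) * (e * Q (y t)))).
  { apply Rmult_le_pos; [lra|]; apply Rmult_le_pos; [|lra].
    apply Rmult_le_pos; lra. }
  assert (K * ((a * (1 + r) * cos (x t) + (1 + s) * cos (y t)) * G) <=
          K * ((a * (1 + r) + (1 + s)) * G)); [|lra].
  apply Rmult_le_compat_l; [lra|]; apply Rmult_le_compat_r; [lra|].
  assert (0 < a * (1 + r)) by nra; nra.
Qed.

(** If e Y <= 0 throughout, then e x' = (1 + r) e Y - e Q <= - m, and x leaves the strip. The time 4
    / m suffices because the strip has width pi <= 4. *)
Lemma Y_pos_somewhere x y :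
  sol x y -> (forall t, - (PI / 2) < x t < PI / 2) ->
  exists t, 0 < e * Y (x t) (y t).
Proof.
intros H Hx; apply NNPP; intros Hn.
assert (HY : forall t, e * Y (x t) (y t) <= 0).
{ intros t; apply Rnot_lt_le; intros Ht; apply Hn; now exists t. }
destruct (derive_mean_value x (fun t => X (x t) (y t)) 0 (4 / m))
  as [c [_ Hc]].
- apply Rdiv_lt_0_compat; lra.
- apply H.
- specialize (HY c); specialize (hQm (y c)); assert (H0 := Hx 0).
  specialize (Hx (4 / m)); rewrite X_Q in Hc.
  assert (HP := PI_4).
  assert (He : e * (x (4 / m) - x 0) <= -4).
  { rewrite Hc; replace (e * (((1 + r) * Y (x c) (y c) - Q (y c)) * (4 / m - 0)))
      with (((1 + r) * (e * Y (x c) (y c)) - e * Q (y c)) * (4 / m)) by ring.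
    replace (-4) with (- m * (4 / m)) by (field; lra).
    apply Rmult_le_compat_r; [|nra].
    left; apply Rdiv_lt_0_compat; lra. }
  destruct he as [-> | ->]; lra.
Qed.

(* The return map of the transversal (1 + r) y - x = 0 to its translate by one
   turn of y; the vertical displacement is 2 pi e exactly when x returns. *)
Definition section_return (x0 p : R) :=
  exists x y t1, sol x y /\ x 0 = x0 /\ y 0 = x0 / (1 + r) /\
    0 < t1 <= 2 * PI * (1 + r) / m /\
    e * ((1 + r) * y t1 - x t1) = 2 * PI * (1 + r) /\ x t1 = p.

Lemma drift_derive x y t :
  sol x y -> is_derive (fun t => e * ((1 + r) * y t - x t)) t (e * Q (y t)).
Proof.
intros H; destruct (H t) as [Hx Hy]; auto_derive.
- repeat split; eexists; eassumption.
- rewrite_derive Hx; rewrite_derive Hy; rewrite X_Q; ring.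
Qed.

Lemma drift_growth x y u v : sol x y -> u <= v ->
  m * (v - u) <= e * ((1 + r) * y v - x v) - e * ((1 + r) * y u - x u).
Proof.
intros H [Huv | ->]; [|lra].
destruct (derive_mean_value (fun t => e * ((1 + r) * y t - x t))
  (fun t => e * Q (y t)) u v Huv) as [c [_ ->]].
- intros t; now apply drift_derive.
- apply Rmult_le_compat_r; [lra|apply hQm].
Qed.

(** The drift starts at 0 and grows at rate at least [m], so it reaches 2 pi (1 + r) within the time
    allowed. *)
Lemma section_return_exists x0 : exists p, section_return x0 p.
Proof.
assert (HP := PI_RGT_0).
assert (Hw : 0 < 2 * PI * (1 + r)) by nra.
destruct (sol_exists x0 (x0 / (1 + r))) as [x [y [H [Hx0 Hy0]]]].
assert (HT : 0 < 2 * PI * (1 + r) / m) by now apply Rdiv_lt_0_compat.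
assert (Hg := drift_growth x y 0 _ H (Rlt_le _ _ HT)).
replace (m * (2 * PI * (1 + r) / m - 0)) with (2 * PI * (1 + r)) in Hg
  by (field; lra).
assert (H0 : e * ((1 + r) * y 0 - x 0) = 0).
{ rewrite Hx0, Hy0; field; lra. }
destruct (IVT_gen (fun t => e * ((1 + r) * y t - x t)) 0
  (2 * PI * (1 + r) / m) (2 * PI * (1 + r))) as [t1 [Ht1 Hw1]].
- intros t; eapply is_derive_continuity_pt; now apply drift_derive.
- rewrite H0, Rmin_left, Rmax_right by lra; lra.
- rewrite Rmin_left, Rmax_right in Ht1 by lra.
  exists (x t1), x, y, t1; repeat split; try apply H; try assumption; try lra.
  destruct Ht1 as [[Hlt | <-] _]; [assumption|]; lra.
Qed.

(** For c >= 1 one has c <= c^2; the cruder constant avoids square roots. *)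
Lemma abs_le_of_sq (u v c : R) : 1 <= c -> u ^ 2 <= c * v ^ 2 ->
  Rabs u <= c * Rabs v.
Proof.
intros Hc H; rewrite <- (Rabs_pos_eq c), <- Rabs_mult by lra.
apply Rsqr_le_abs_0; unfold Rsqr; assert (Hp := pow2_ge_0 v); nra.
Qed.

(** The solutions separate by at most E D at a common time; their return times then differ by at
    most (2 + r) E D / m, since the drift grows at rate at least m; meanwhile x moves with speed at
    most B. For equal starting points this also makes the relation single-valued. *)
Lemma section_return_lipschitz : exists C, 0 < C /\
  forall x0 p x0' p', section_return x0 p -> section_return x0' p' ->
  Rabs (p - p') <= C * Rabs (x0 - x0').
Proof.
assert (HP := PI_RGT_0).
(* The factor 2 accounts for the initial gap in y, which is at most the one in x because both points
   lie on the transversal. *)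
set (E := 2 * exp (growth * (2 * PI * (1 + r) / m))).
set (B := Rabs nux + K * (a * (1 + r) + 1)).
assert (HT : 0 < 2 * PI * (1 + r) / m) by (apply Rdiv_lt_0_compat; nra).
assert (Hgr := growth_pos).
assert (HE : 1 <= E).
{ unfold E; assert (Hq := exp_ineq1_le (growth * (2 * PI * (1 + r) / m))).
  assert (0 < growth * (2 * PI * (1 + r) / m))
    by now apply Rmult_lt_0_compat.
  lra. }
assert (HB : 0 < B).
{ unfold B; assert (H := Rabs_pos nux); assert (0 < a * (1 + r)) by nra; nra. }
exists (E + B * ((2 + r) * E / m)); split.
{ apply Rplus_lt_0_compat; [lra|]; apply Rmult_lt_0_compat; [assumption|].
  apply Rdiv_lt_0_compat; nra. }
intros x0 p x0' p' [x [y [t [H [Hx0 [Hy0 [Ht [Hw Hp]]]]]]]]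
  [x' [y' [t' [H' [Hx0' [Hy0' [Ht' [Hw' Hp']]]]]]]].
set (D := Rabs (x0 - x0')).
assert (HD : 0 <= D) by apply Rabs_pos.
assert (Hdist : (x t - x' t) ^ 2 + (y t - y' t) ^ 2 <= E * (x0 - x0') ^ 2).
{ apply Rle_trans with (1 := sol_distance x y x' y' 0 t H H').
  rewrite Hx0, Hx0', Hy0, Hy0'; unfold E.
  assert (Hq : (x0 / (1 + r) - x0' / (1 + r)) ^ 2 <= (x0 - x0') ^ 2).
  { replace ((x0 / (1 + r) - x0' / (1 + r)) ^ 2) with
      ((x0 - x0') ^ 2 * / (1 + r) ^ 2) by (field; lra).
    rewrite <- (Rmult_1_r ((x0 - x0') ^ 2)) at 2.
    apply Rmult_le_compat_l; [apply pow2_ge_0|].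
    rewrite <- Rinv_1; apply Rinv_le_contravar; nra. }
  assert (Hexp : exp (growth * Rabs (t - 0)) <=
                 exp (growth * (2 * PI * (1 + r) / m))).
  { apply exp_nondecreasing, Rmult_le_compat_l; [lra|].
    rewrite Rabs_pos_eq; lra. }
  assert (Hp1 := pow2_ge_0 (x0 - x0')).
  assert (Hp2 := exp_pos (growth * Rabs (t - 0))).
  nra. }
assert (Hdx : Rabs (x t - x' t) <= E * D).
{ apply abs_le_of_sq; [assumption|].
  assert (Hq := pow2_ge_0 (y t - y' t)); lra. }
assert (Hdy : Rabs (y t - y' t) <= E * D).
{ apply abs_le_of_sq; [assumption|].
  assert (Hq := pow2_ge_0 (x t - x' t)); lra. }
assert (HW : Rabs (e * ((1 + r) * y' t - x' t) - e * ((1 + r) * y' t' - x' t'))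
             <= (2 + r) * E * D).
{ rewrite Hw', <- Hw.
  apply Rabs_le_between in Hdx; apply Rabs_le_between in Hdy.
  apply Rabs_le; destruct he as [-> | ->]; nra. }
assert (Htt : Rabs (t - t') <= (2 + r) * E / m * D).
{ replace ((2 + r) * E / m * D) with ((2 + r) * E * D / m) by (field; lra).
  apply Rle_div_r; [lra|]; apply Rabs_le_between in HW.
  destruct (Rle_lt_dec t t') as [Hle|Hlt].
  - assert (Hg := drift_growth x' y' t t' H' Hle).
    rewrite Rabs_minus_sym, Rabs_pos_eq by lra; lra.
  - assert (Hg := drift_growth x' y' t' t H' (Rlt_le _ _ Hlt)).
    rewrite Rabs_pos_eq by lra; lra. }
assert (Hx' : Rabs (x' t - x' t') <= B * Rabs (t - t')).
{ apply (bounded_derive_lipschitz x' (fun t => X (x' t) (y' t))); [apply H'|].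
  intros u; now apply X_bound. }
assert (HBm : B * Rabs (t - t') <= B * ((2 + r) * E / m * D))
  by (apply Rmult_le_compat_l; lra).
replace (p - p') with ((x t - x' t) + (x' t - x' t')) by lra.
apply Rle_trans with (1 := Rabs_triang _ _); lra.
Qed.

Lemma le_of_le_plus_small (p q C : R) :
  0 < C -> (forall d, 0 < d < 1 -> p <= q + C * d) -> p <= q.
Proof.
intros HC H; apply Rnot_lt_le; intros Hlt.
assert (Hd : 0 < Rmin (1 / 2) ((p - q) / (2 * C))).
{ apply Rmin_pos; [lra|]; apply Rdiv_lt_0_compat; lra. }
assert (H1 := Rmin_l (1 / 2) ((p - q) / (2 * C))).
assert (H2 := Rmin_r (1 / 2) ((p - q) / (2 * C))).
specialize (H (Rmin (1 / 2) ((p - q) / (2 * C))) ltac:(lra)).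
apply (Rmult_le_compat_l C) in H2; [|lra].
replace (C * ((p - q) / (2 * C))) with ((p - q) / 2) in H2 by (field; lra).
lra.
Qed.

Lemma section_return_strip x0 p :
  - (PI / 2) < x0 < PI / 2 -> section_return x0 p -> - (PI / 2) < p < PI / 2.
Proof.
intros Hx0 [x [y [t1 [H [Hx [_ [Ht1 [_ <-]]]]]]]].
apply (strip_connected x 0 t1).
- now apply (sol_continuity x y).
- intros u Hu; rewrite Rmin_left, Rmax_right in Hu by lra.
  apply (cos_forward x y 0); trivial; [|lra].
  rewrite Hx; apply cos_gt_0; lra.
- rewrite Hx; lra.
Qed.

Lemma section_return_fixed :
  exists x0, - (PI / 2) <= x0 <= PI / 2 /\ section_return x0 x0.
Proof.
assert (HP := PI2_3_2).
destruct (functional_choice section_return section_return_exists) as [P HPret].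
destruct section_return_lipschitz as [C [HC HL]].
assert (HPl : forall u v, Rabs (P v - P u) <= C * Rabs (v - u)).
{ intros u v; now apply HL. }
(* The open strip is preserved, so the edge is approached from inside and the Lipschitz bound passes
   to the limit. *)
assert (Hhi : P (PI / 2) <= PI / 2).
{ apply le_of_le_plus_small with C; [assumption|]; intros d Hd.
  assert (Hs := section_return_strip (PI / 2 - d) _ ltac:(lra) (HPret _)).
  assert (Hl := HPl (PI / 2) (PI / 2 - d)).
  replace (PI / 2 - d - PI / 2) with (- d) in Hl by ring.
  rewrite Rabs_Ropp, (Rabs_pos_eq d) in Hl by lra.
  apply Rabs_le_between in Hl; lra. }
assert (Hlo : - P (- (PI / 2)) <= PI / 2).
{ apply le_of_le_plus_small with C; [assumption|]; intros d Hd.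
  assert (Hs := section_return_strip (- (PI / 2) + d) _ ltac:(lra) (HPret _)).
  assert (Hl := HPl (- (PI / 2)) (- (PI / 2) + d)).
  replace (- (PI / 2) + d - - (PI / 2)) with d in Hl by ring.
  rewrite (Rabs_pos_eq d) in Hl by lra.
  apply Rabs_le_between in Hl; lra. }
destruct (IVT_cor (fun u => P u - u) (- (PI / 2)) (PI / 2)) as [x0 [Hx0 Hfix]].
- intros t; apply continuity_pt_filterlim.
  apply (lipschitz_continuous (fun u => P u - u) (C + 1)); intros u v.
  apply Rle_trans with (Rabs (P v - P u) + Rabs (- (v - u))).
  + replace (P v - v - (P u - u)) with (P v - P u + - (v - u)) by ring.
    apply Rabs_triang.
  + rewrite Rabs_Ropp; specialize (HPl u v); lra.
- lra.
- nra.
- exists x0; split; [assumption|]; rewrite <- (Rminus_diag_uniq _ _ Hfix) at 2.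
  apply HPret.
Qed.

Lemma e_IZR : exists l : Z, e = IZR l.
Proof. destruct he as [-> | ->]; [now exists 1%Z|now exists (-1)%Z]. Qed.

Lemma periodic_sol_exists : exists x y T, sol x y /\ 0 < T /\
  (forall t, x (t + T) = x t /\ y (t + T) = y t + 2 * PI * e) /\
  (forall t, - (PI / 2) < x t < PI / 2) /\
  (forall t, 0 < e * Y (x t) (y t)).
Proof.
destruct section_return_fixed as [x0 [Hx0 Hret]].
destruct Hret as [x [y [T [H [Hx [Hy [HT [Hw Hp]]]]]]]].
destruct e_IZR as [l Hl].
assert (HyT : y T = y 0 + 2 * PI * e).
{ rewrite Hp in Hw; rewrite Hy.
  assert (Hyt : (1 + r) * y T = x0 + 2 * PI * (1 + r) * e)
    by (destruct he as [Heq | Heq]; rewrite Heq in Hw |- *; lra).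
  apply (Rmult_eq_reg_l (1 + r)); [|lra]; rewrite Hyt; field; lra. }
assert (Hper : forall t, x (t + T) = x t /\ y (t + T) = y t + 2 * PI * e).
{ intros t.
  destruct (sol_unique (fun t => x (t + T)) (fun t => y (t + T))
    (fun t => x t + 2 * PI * IZR 0) (fun t => y t + 2 * PI * IZR l) 0)
    with (t := t) as [H1 H2].
  - now apply sol_shift.
  - now apply sol_torus.
  - rewrite Rplus_0_l; lra.
  - rewrite Rplus_0_l, <- Hl; assumption.
  - rewrite <- Hl in H2; split; [lra|assumption]. }
assert (Hp' : per x y T).
{ split; [lra|]; intros t; exists 0%Z, l; rewrite <- Hl.
  destruct (Hper t) as [-> ->]; split; ring. }
(* The fixed point may lie on an edge a priori; but cos x has a strict sign along a periodic
   solution, and cos x0 >= 0. *)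
assert (Hcos : forall t, 0 < cos (x t)).
{ destruct (cos_sign_per x y T H Hp') as [Hc|Hc]; trivial.
  specialize (Hc 0); rewrite Hx in Hc.
  assert (Hc' := cos_ge_0 x0); lra. }
assert (Hstrip : forall t, - (PI / 2) < x t < PI / 2).
{ intros t; apply (strip_connected x 0 t).
  - now apply (sol_continuity x y).
  - intros u _; apply Hcos.
  - rewrite Hx; specialize (Hcos 0); rewrite Hx in Hcos.
    split; apply Rnot_le_lt; intros Hb.
    + replace x0 with (- (PI / 2)) in Hcos by lra.
      rewrite cos_neg, cos_PI2 in Hcos; lra.
    + replace x0 with (PI / 2) in Hcos by lra; rewrite cos_PI2 in Hcos; lra. }
exists x, y, T; split; [assumption|]; split; [lra|].
split; [assumption|]; split; [assumption|].
(* Positive once, e Y is positive from then on, and by periodicity always. *)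
destruct (Y_pos_somewhere x y H Hstrip) as [t0 Ht0]; intros t.
destruct (exists_INR_gt ((t0 - t) / T)) as [n Hn].
destruct (per_iter x y T n t Hp') as [k [j [Hxn Hyn]]].
rewrite <- (proj2 (field_torus (x t) (y t) k j)), <- Hxn, <- Hyn.
apply (Y_pos_forward x y t0 H).
- intros u _; left; apply Hcos.
- assumption.
- apply (Rmult_lt_compat_r T) in Hn; [|lra].
  unfold Rdiv in Hn; rewrite Rmult_assoc, Rinv_l in Hn by lra; lra.
Qed.

(** * The invariant graph and its stability *)

(** Along the periodic solution e y increases, so time is a function of y and xi solves dx/dy = X /
    Y. The strict inequalities become the margins [eta] and [c] by compactness of one period. *)
Lemma graph_exists : exists (xi : R -> R) (eta c : R),
  (0 < eta <= PI / 2 /\ 0 < c) /\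
  (forall v, is_derive xi v (X (xi v) v / Y (xi v) v)) /\
  (forall v (k : Z), xi (v + 2 * PI * IZR k) = xi v) /\
  (forall v, - (PI / 2) + eta <= xi v <= PI / 2 - eta) /\
  (forall v, c <= e * Y (xi v) v) /\
  exists x y, sol x y /\ forall t, x t = xi (y t).
Proof.
destruct periodic_sol_exists as [x [y [T [H [HT [Hper [Hstrip HY]]]]]]].
destruct (sol_continuity x y H) as [Hcx Hcy].
destruct e_IZR as [l Hl].
assert (Hee : e * e = 1) by (destruct he as [-> | ->]; ring).
assert (He0 : e <> 0) by (destruct he; lra).
destruct (periodic_lower_bound (fun t => e * Y (x t) (y t)) T) as [c [Hc HcY]];
  trivial.
{ intros t; destruct (H t) as [Hx Hy]; unfold Y.
  apply is_derive_continuity_pt with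
    (- e * K * (a * cos (x t) * X (x t) (y t)
                + (1 + s) * cos (y t) * Y (x t) (y t))).
  auto_derive; [repeat split; eexists; eassumption|].
  rewrite_derive Hx; rewrite_derive Hy; ring. }
{ intros t; destruct (Hper t) as [-> ->]; rewrite Hl.
  replace (x t) with (x t + 2 * PI * IZR 0) at 1 by ring.
  now rewrite (proj2 (field_torus _ _ _ _)). }
destruct (periodic_lower_bound (fun t => PI / 2 - x t) T) as [c1 [Hc1 Hx1]];
  trivial.
{ intros t; apply (continuity_pt_minus (fun _ => PI / 2)); [|apply Hcx].
  apply continuity_pt_const; now intros u v. }
{ intros t; now rewrite (proj1 (Hper t)). }
{ intros t; specialize (Hstrip t); lra. }
destruct (periodic_lower_bound (fun t => PI / 2 + x t) T) as [c2 [Hc2 Hx2]];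
  trivial.
{ intros t; apply (continuity_pt_plus (fun _ => PI / 2)); [|apply Hcx].
  apply continuity_pt_const; now intros u v. }
{ intros t; now rewrite (proj1 (Hper t)). }
{ intros t; specialize (Hstrip t); lra. }
destruct (inverse_derive (fun t => e * y t) (fun t => e * Y (x t) (y t)) c)
  as [h [Hgh [Hhg Hdh]]]; trivial.
{ intros t; apply is_derive_scal, H. }
assert (Hyh : forall v, y (h (e * v)) = v).
{ intros v; apply (Rmult_eq_reg_l e); [|assumption]; apply Hgh. }
set (xi := fun v => x (h (e * v))).
exists xi, (Rmin c1 c2), c.
assert (Hm1 := Rmin_l c1 c2); assert (Hm2 := Rmin_r c1 c2).
split; [|split; [|split; [|split; [|split]]]].
- split; [split|assumption].
  + now apply Rmin_pos.
  + specialize (Hx1 0); specialize (Hx2 0); lra.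
- intros v; specialize (Hdh (e * v)); rewrite Hyh in Hdh.
  destruct (H (h (e * v))) as [Hx _]; rewrite Hyh in Hx.
  fold (xi v) in Hx, Hdh.
  assert (HY0 : e * Y (xi v) v <> 0).
  { specialize (HY (h (e * v))); rewrite Hyh in HY; fold (xi v) in HY; lra. }
  evar_last.
  { apply (is_derive_comp x (fun v => h (e * v))); [exact Hx|].
    apply (is_derive_comp h (fun v => e * v)); [exact Hdh|].
    apply (is_derive_scal (fun v => v)), @is_derive_id. }
  unfold scal, one; simpl; unfold mult; simpl; field.
  split; [intros H0; apply HY0; rewrite H0; ring|assumption].
- assert (Hxi : forall v, xi (v + 2 * PI * e) = xi v).
  { intros v; unfold xi.
    replace (e * (v + 2 * PI * e)) with (e * y (h (e * v) + T)).
    - rewrite Hhg; apply Hper.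
    - rewrite (proj2 (Hper _)), Hyh; reflexivity. }
  intros v k.
  (* The known period is 2 pi e; since e^2 = 1, a shift by k turns is e k such periods. *)
  rewrite <- (periodic_Z xi (2 * PI * e) Hxi (l * k) v), mult_IZR, <- Hl.
  f_equal; replace (e * IZR k * (2 * PI * e)) with
    ((e * e) * (2 * PI * IZR k)) by ring; rewrite Hee; ring.
- intros v; unfold xi; specialize (Hx1 (h (e * v))); specialize (Hx2 (h (e * v))).
  lra.
- intros v; specialize (HcY (h (e * v))); now rewrite Hyh in HcY.
- exists x, y; split; [assumption|]; intros t; unfold xi; now rewrite Hhg.
Qed.

Context (xi : R -> R) (eta c : R) (heta : 0 < eta <= PI / 2) (hc : 0 < c)
  (hxi : forall v, is_derive xi v (X (xi v) v / Y (xi v) v))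
  (hxiper : forall v (k : Z), xi (v + 2 * PI * IZR k) = xi v)
  (hxistrip : forall v, - (PI / 2) + eta <= xi v <= PI / 2 - eta)
  (hxiY : forall v, c <= e * Y (xi v) v).

Lemma Y_xi_nonzero v : Y (xi v) v <> 0.
Proof. intros H0; specialize (hxiY v); rewrite H0 in hxiY; lra. Qed.

(* X(x) Y(xi) - Y(x) X(xi) = Q (Y(x) - Y(xi)) because X = (1 + r) Y - Q, and
   Y(x) - Y(xi) is a negative multiple of sin x - sin xi. *)
Lemma graph_distance_derive x y (k : Z) t : sol x y ->
  is_derive (fun t => x t + 2 * PI * IZR k - xi (y t)) t
    (- (K * a * (e * Q (y t)) / (e * Y (xi (y t)) (y t)))
     * (sin (x t + 2 * PI * IZR k) - sin (xi (y t)))).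
Proof.
intros H; destruct (H t) as [Hx Hy].
assert (H0 := Y_xi_nonzero (y t)).
assert (He0 : e <> 0) by (destruct he; lra).
evar_last.
{ apply is_derive_Rminus.
  - apply (is_derive_plus x); [exact Hx|apply (is_derive_const (2 * PI * IZR k))].
  - apply (is_derive_comp xi y); [apply hxi|exact Hy]. }
unfold plus, zero, scal; simpl; unfold mult; simpl.
rewrite (proj1 (sin_cos_shift (x t) k)), !X_Q.
assert (HYd : Y (x t) (y t) - Y (xi (y t)) (y t) =
              - K * a * (sin (x t) - sin (xi (y t)))) by (unfold Y; ring).
replace (- (K * a * (e * Q (y t)) / (e * Y (xi (y t)) (y t))) *
  (sin (x t) - sin (xi (y t)))) with
  (Q (y t) / Y (xi (y t)) (y t) * (- K * a * (sin (x t) - sin (xi (y t)))))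
  by (field; now split).
rewrite <- HYd; field; assumption.
Qed.

(** A lower bound for the decay rate of d^2: 2 from the square, the quotient from e Q >= m and the
    upper bound of |Y|, and sin th from [sin_gap]. *)
Definition rate (th : R) :=
  2 * (K * a * m / (Rabs nuy + K * (a + (1 + s)))) * sin th.

Lemma rate_pos th : 0 < th <= PI / 2 -> 0 < rate th.
Proof.
intros Hth; unfold rate; assert (Hn := Rabs_pos nuy); assert (HP := PI_RGT_0).
apply Rmult_lt_0_compat; [|apply sin_gt_0; lra].
apply Rmult_lt_0_compat; [lra|]; apply Rdiv_lt_0_compat; nra.
Qed.

(** The margin [th] stays free: stability takes eta / 2, whereas a given periodic orbit only has
    some margin of its own. The integer [k] selects the lift of x lying in the strip. *)
Lemma graph_contraction x y (k : Z) th : 0 < th <= PI / 2 ->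
  (forall v, - (PI / 2) + th <= xi v <= PI / 2 - th) -> sol x y ->
  exists dE, (forall t,
    is_derive (fun t => (x t + 2 * PI * IZR k - xi (y t)) ^ 2) t (dE t)) /\
  forall t, - (PI / 2) + th <= x t + 2 * PI * IZR k <= PI / 2 - th ->
    dE t <= - rate th * (x t + 2 * PI * IZR k - xi (y t)) ^ 2.
Proof.
intros Hth Hxi H.
set (d := fun t => x t + 2 * PI * IZR k - xi (y t)).
set (cc := fun t => K * a * (e * Q (y t)) / (e * Y (xi (y t)) (y t))).
exists (fun t => 2 * d t * (- cc t *
  (sin (x t + 2 * PI * IZR k) - sin (xi (y t))))); split.
- intros t.
  assert (Hd : is_derive d t (- cc t *
    (sin (x t + 2 * PI * IZR k) - sin (xi (y t)))))
    by now apply graph_distance_derive.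
  change (is_derive (fun t => d t ^ 2) t (2 * d t * (- cc t *
    (sin (x t + 2 * PI * IZR k) - sin (xi (y t)))))).
  auto_derive; [now eexists; eassumption|].
  rewrite_derive Hd; ring.
- intros t Hx.
  assert (Hgap := sin_gap th _ _ Hth Hx (Hxi (y t))); fold (d t) in Hgap.
  change (2 * d t * (- cc t * (sin (x t + 2 * PI * IZR k) - sin (xi (y t))))
          <= - rate th * d t ^ 2).
  assert (HYb := Y_bound (xi (y t)) (y t)); assert (Hcy := hxiY (y t)).
  set (M := Rabs nuy + K * (a + (1 + s))) in *.
  assert (HYM : e * Y (xi (y t)) (y t) <= M).
  { apply Rabs_le_between in HYb; destruct he as [-> | ->]; lra. }
  assert (Hcc : K * a * m / M <= cc t).
  { unfold cc, Rdiv; apply Rmult_le_compat.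
    - apply Rmult_le_pos; nra.
    - left; apply Rinv_0_lt_compat; lra.
    - apply Rmult_le_compat_l; [nra|apply hQm].
    - apply Rinv_le_contravar; lra. }
  assert (Hc0 : 0 <= K * a * m / M).
  { apply Rdiv_le_0_compat; [|lra]; apply Rmult_le_pos; nra. }
  unfold rate; fold M.
  assert (Hs : 0 <= sin th * d t ^ 2).
  { apply Rmult_le_pos; [|apply pow2_ge_0].
    assert (HP := PI_RGT_0); apply sin_ge_0; lra. }
  assert (K * a * m / M * (sin th * d t ^ 2) <=
    cc t * (d t * (sin (x t + 2 * PI * IZR k) - sin (xi (y t))))).
  { apply Rmult_le_compat; lra. }
  lra.
Qed.

(** Over one period d^2 returns to its value, yet it is multiplied by a factor below 1; so it
    vanishes. *)
Lemma per_on_graph x y T : sol x y -> per x y T -> (forall t, 0 < cos (x t)) ->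
  exists k : Z, forall t, x t + 2 * PI * IZR k = xi (y t).
Proof.
intros H [HT Hper] Hcos.
destruct (sol_continuity x y H) as [Hcx Hcy].
destruct (cos_pos_strip (x 0) (Hcos 0)) as [k Hk]; exists k.
assert (Hcx' : forall t, continuity_pt (fun t => x t + 2 * PI * IZR k) t).
{ intros t; apply (continuity_pt_plus x); [apply Hcx|].
  apply continuity_pt_const; now intros u v. }
assert (Hstrip : forall t, - (PI / 2) < x t + 2 * PI * IZR k < PI / 2).
{ intros t; apply (strip_connected (fun t => x t + 2 * PI * IZR k) 0 t); trivial.
  intros u _; now rewrite (proj2 (sin_cos_shift _ _)). }
assert (Hx : forall t, x (t + T) = x t).
{ intros t; destruct (Hper t) as [j [_ [Hj _]]].
  assert (H1 := Hstrip t); assert (H2 := Hstrip (t + T)); rewrite Hj in *.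
  assert (HP := PI_RGT_0).
  (* A strip of width pi contains no two points differing by a nonzero multiple of 2 pi. *)
  assert (Hj0 : j = 0%Z).
  { assert (-1 < IZR j < 1) by nra.
    assert ((-1 < j < 1)%Z) by (split; apply lt_IZR; lra); lia. }
  rewrite Hj0; ring. }
destruct (periodic_lower_bound (fun t => PI / 2 - (x t + 2 * PI * IZR k)) T)
  as [c1 [Hc1 Hx1]]; trivial.
{ intros t; apply (continuity_pt_minus (fun _ => PI / 2)); [|apply Hcx'].
  apply continuity_pt_const; now intros u v. }
{ intros t; now rewrite Hx. }
{ intros t; specialize (Hstrip t); lra. }
destruct (periodic_lower_bound (fun t => PI / 2 + (x t + 2 * PI * IZR k)) T)
  as [c2 [Hc2 Hx2]]; trivial.
{ intros t; apply (continuity_pt_plus (fun _ => PI / 2)); [|apply Hcx'].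
  apply continuity_pt_const; now intros u v. }
{ intros t; now rewrite Hx. }
{ intros t; specialize (Hstrip t); lra. }
set (th := Rmin eta (Rmin c1 c2)).
assert (Hth : 0 < th).
{ unfold th; apply Rmin_pos; [lra|]; now apply Rmin_pos. }
assert (Ht1 : th <= eta) by apply Rmin_l.
assert (Ht2 : th <= Rmin c1 c2) by apply Rmin_r.
assert (Ht3 := Rmin_l c1 c2); assert (Ht4 := Rmin_r c1 c2).
destruct (graph_contraction x y k th) as [dE [HdE Hle]]; trivial; try lra.
{ intros v; specialize (hxistrip v); lra. }
intros t.
assert (HE := exp_decay (fun t => (x t + 2 * PI * IZR k - xi (y t)) ^ 2) dE
  (rate th) t (t + T)); cbv beta in HE.
destruct (Hper t) as [_ [j [_ Hyj]]].
rewrite Hx, Hyj, hxiper in HE.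
assert (Hexp : exp (- rate th * (t + T - t)) < 1).
{ rewrite <- exp_0; apply exp_increasing.
  assert (Hrate := rate_pos th); nra. }
assert (Hsq := pow2_ge_0 (x t + 2 * PI * IZR k - xi (y t))).
assert (Hz : (x t + 2 * PI * IZR k - xi (y t)) ^ 2 = 0).
{ specialize (HE ltac:(lra) HdE).
  assert (HE' := HE (fun u _ => Hle u ltac:(specialize (Hx1 u);
    specialize (Hx2 u); lra))).
  nra. }
rewrite <- Rsqr_pow2 in Hz; apply Rsqr_0_uniq in Hz; lra.
Qed.

Lemma on_graph_velocity x y (k : Z) : sol x y ->
  (forall t, x t + 2 * PI * IZR k = xi (y t)) ->
  forall t, c <= e * Y (x t) (y t).
Proof.
intros H Hg t; rewrite <- (proj2 (field_torus (x t) (y t) k 0)).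
replace (y t + 2 * PI * 0) with (y t) by ring; rewrite Hg; apply hxiY.
Qed.

Lemma on_graph_growth x y (k : Z) u v : sol x y ->
  (forall t, x t + 2 * PI * IZR k = xi (y t)) -> u <= v ->
  c * (v - u) <= e * y v - e * y u.
Proof.
intros H Hg [Huv | ->]; [|lra].
destruct (derive_mean_value (fun t => e * y t) (fun t => e * Y (x t) (y t))
  u v Huv) as [w [_ ->]].
- intros t; apply is_derive_scal, H.
- apply Rmult_le_compat_r; [lra|]; now apply (on_graph_velocity x y k).
Qed.

Lemma on_graph_surjective x y (k : Z) v : sol x y ->
  (forall t, x t + 2 * PI * IZR k = xi (y t)) -> exists t, y t = v.
Proof.
intros H Hg.
destruct (inverse_derive (fun t => e * y t) (fun t => e * Y (x t) (y t)) c)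
  as [h [Hh _]]; trivial.
- intros t; apply is_derive_scal, H.
- now apply (on_graph_velocity x y k).
- exists (h (e * v)); specialize (Hh (e * v)); cbv beta in Hh.
  destruct he as [He | He]; rewrite He in Hh |- *; lra.
Qed.

(** [T] is the time in which y makes one turn; x returns with it because xi is 2 pi periodic, and
    uniqueness extends the shift from time 0 to all times. *)
Lemma on_graph_period x y (k : Z) : sol x y ->
  (forall t, x t + 2 * PI * IZR k = xi (y t)) ->
  exists T, per x y T /\ (forall T', per x y T' -> T <= T') /\
    forall t, x (t + T) = x t /\ y (t + T) = y t + 2 * PI * e.
Proof.
intros H Hg; destruct e_IZR as [l Hl]; assert (HP := PI_RGT_0).
assert (Hee : e * e = 1) by (destruct he as [-> | ->]; ring).
destruct (on_graph_surjective x y k (y 0 + 2 * PI * e) H Hg) as [T HyT].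
assert (HT : 0 < T).
{ apply Rnot_le_lt; intros HT; assert (Hgr := on_graph_growth x y k T 0 H Hg HT).
  rewrite HyT in Hgr.
  assert (e * (y 0 + 2 * PI * e) = e * y 0 + 2 * PI)
    by (rewrite Rmult_plus_distr_l; replace (e * (2 * PI * e)) with
          (2 * PI * (e * e)) by ring; rewrite Hee; ring).
  nra. }
assert (Hsh : forall t, x (t + T) = x t /\ y (t + T) = y t + 2 * PI * e).
{ intros t.
  destruct (sol_unique (fun t => x (t + T)) (fun t => y (t + T))
    (fun t => x t + 2 * PI * IZR 0) (fun t => y t + 2 * PI * IZR l) 0)
    with (t := t) as [H1 H2].
  - now apply sol_shift.
  - now apply sol_torus.
  - rewrite Rplus_0_l.
    assert (HxT := Hg T); rewrite HyT, Hl, hxiper, <- Hg in HxT; lra.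
  - rewrite Rplus_0_l, <- Hl; assumption.
  - rewrite <- Hl in H2; split; [lra|assumption]. }
exists T; split; [|split]; trivial.
- split; [assumption|]; intros t; exists 0%Z, l; rewrite <- Hl.
  destruct (Hsh t) as [-> ->]; split; ring.
(* By monotonicity of e y, a shorter period would correspond to a number of turns strictly between 0
   and 1. *)
- intros T' [HT' Hper']; apply Rnot_lt_le; intros Hlt.
  destruct (Hper' 0) as [_ [j [_ Hj]]]; rewrite Rplus_0_l in Hj.
  assert (H1 := on_graph_growth x y k 0 T' H Hg (Rlt_le _ _ HT')).
  assert (H2 := on_graph_growth x y k T' T H Hg (Rlt_le _ _ Hlt)).
  rewrite Hj in H1, H2; rewrite HyT in H2.
  assert (H3 : 0 < 2 * PI * (e * IZR j)) by nra.
  assert (H4 : 2 * PI * (e * IZR j) < 2 * PI * (e * e)) by nra.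
  rewrite Hee in H4.
  assert (H5 : 0 < e * IZR j < 1) by nra.
  rewrite Hl, <- mult_IZR in H5.
  assert ((0 < l * j < 1)%Z) by (split; apply lt_IZR; lra); lia.
Qed.

Let F := vector_field a r s K nux nuy.
Let fx (z : R -> R * R) := fun t => fst (z t).
Let fy (z : R -> R * R) := fun t => snd (z t).

Lemma near_orbit_iff g eps p : near_orbit g eps p <->
  exists u (k l : Z), Rabs (fst p + 2 * PI * IZR k - fst (g u)) < eps /\
    Rabs (snd p + 2 * PI * IZR l - snd (g u)) < eps.
Proof.
split.
- intros [u [q [[k [l [Hk Hl]]] [H1 H2]]]]; exists u, k, l.
  now rewrite <- Hk, <- Hl.
- intros [u [k [l [H1 H2]]]].
  exists u, (fst p + 2 * PI * IZR k, snd p + 2 * PI * IZR l); split.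
  + now exists k, l.
  + now split.
Qed.

(** The bound of |X| over the lower bound of |Y| on the graph: a Lipschitz constant of xi. *)
Definition slope := (Rabs nux + K * (a * (1 + r) + 1)) / c.

Lemma slope_nonneg : 0 <= slope.
Proof.
unfold slope; assert (H := Rabs_pos nux); assert (H1 : 0 < a * (1 + r)) by nra.
apply Rdiv_le_0_compat; nra.
Qed.

Lemma xi_lipschitz u v : Rabs (xi v - xi u) <= slope * Rabs (v - u).
Proof.
apply (bounded_derive_lipschitz xi (fun v => X (xi v) v / Y (xi v) v)); [apply hxi|].
intros w; unfold slope, Rdiv; rewrite Rabs_mult.
assert (HY : c <= Rabs (Y (xi w) w)).
{ apply Rle_trans with (1 := hxiY w); assert (H := Rle_abs (Y (xi w) w)).
  assert (H' := Rle_abs (- Y (xi w) w)); rewrite Rabs_Ropp in H'.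
  destruct he as [-> | ->]; lra. }
apply Rmult_le_compat; [apply Rabs_pos|apply Rabs_pos|now apply X_bound|].
rewrite Rabs_inv; apply Rinv_le_contravar; lra.
Qed.

Definition on_graph (z : R -> R * R) :=
  is_solution F z /\
  exists k : Z, forall t, fst (z t) + 2 * PI * IZR k = xi (snd (z t)).

(** The orbit of [g] fills the whole graph, so it has a point with the same y as [p], and only the
    horizontal distance counts. *)
Lemma near_of_distance g eps p (j : Z) : on_graph g ->
  Rabs (fst p + 2 * PI * IZR j - xi (snd p)) < eps -> near_orbit g eps p.
Proof.
intros [Hg [k Hk]] Hd.
destruct (on_graph_surjective (fx g) (fy g) k (snd p) Hg Hk) as [u Hu].
unfold fy in Hu; apply near_orbit_iff; exists u, (j - k)%Z, 0%Z.
rewrite Hu, minus_IZR; specialize (Hk u); rewrite Hu in Hk; split.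
- replace (fst p + 2 * PI * (IZR j - IZR k) - fst (g u)) with
    (fst p + 2 * PI * IZR j - (fst (g u) + 2 * PI * IZR k)) by ring.
  now rewrite Hk.
- replace (snd p + 2 * PI * 0 - snd p) with 0 by ring.
  rewrite Rabs_R0; apply Rle_lt_trans with (2 := Hd), Rabs_pos.
Qed.

Lemma distance_of_near g eps p : on_graph g -> near_orbit g eps p ->
  exists j : Z, Rabs (fst p + 2 * PI * IZR j - xi (snd p)) < (1 + slope) * eps.
Proof.
intros [Hg [k Hk]] Hn; apply near_orbit_iff in Hn.
destruct Hn as [u [j [l [H1 H2]]]]; exists (j + k)%Z; rewrite plus_IZR.
specialize (Hk u); assert (HL := xi_lipschitz (snd (g u)) (snd p + 2 * PI * IZR l)).
rewrite hxiper in HL; assert (Hsl := slope_nonneg).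
assert (HL' : slope * Rabs (snd p + 2 * PI * IZR l - snd (g u)) <= slope * eps)
  by (apply Rmult_le_compat_l; lra).
replace (fst p + 2 * PI * (IZR j + IZR k) - xi (snd p)) with
  ((fst p + 2 * PI * IZR j - fst (g u)) + - (xi (snd p) - xi (snd (g u))))
  by (rewrite <- Hk; ring).
apply Rle_lt_trans with (1 := Rabs_triang _ _); rewrite Rabs_Ropp; lra.
Qed.

(** The contraction estimate holds only while the solution stays within eta / 2 of the graph, which
    itself keeps a margin eta from the edges; the other half of the margin is left for [sin_gap]. *)
Lemma distance_decay x y (k : Z) : sol x y ->
  Rabs (x 0 + 2 * PI * IZR k - xi (y 0)) < eta / 2 ->
  forall t, 0 <= t ->
  (x t + 2 * PI * IZR k - xi (y t)) ^ 2 <=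
  (x 0 + 2 * PI * IZR k - xi (y 0)) ^ 2 * exp (- rate (eta / 2) * t).
Proof.
intros H H0.
destruct (graph_contraction x y k (eta / 2)) as [dE [HdE Hle]]; trivial; try lra.
{ intros v; specialize (hxistrip v); lra. }
assert (Hmargin : forall t, (x t + 2 * PI * IZR k - xi (y t)) ^ 2 <= (eta / 2) ^ 2 ->
  dE t <= - rate (eta / 2) * (x t + 2 * PI * IZR k - xi (y t)) ^ 2).
{ intros t Ht; apply Hle.
  assert (Hb : Rabs (x t + 2 * PI * IZR k - xi (y t)) <= eta / 2).
  { rewrite <- (Rabs_pos_eq (eta / 2)) by lra; apply Rsqr_le_abs_0.
    now rewrite !Rsqr_pow2. }
  apply Rabs_le_between in Hb; specialize (hxistrip (y t)); lra. }
assert (Hrate := rate_pos (eta / 2) ltac:(lra)).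
(* Bootstrap: while d^2 <= (eta / 2)^2 it does not increase, so this region is never left. *)
assert (Hin : forall t, 0 <= t ->
  0 < (eta / 2) ^ 2 - (x t + 2 * PI * IZR k - xi (y t)) ^ 2).
{ apply (positivity_forward
    (fun t => (eta / 2) ^ 2 - (x t + 2 * PI * IZR k - xi (y t)) ^ 2)
    (fun t => 0 - dE t) 0).
  - intros t; apply is_derive_Rminus; [|apply HdE].
    apply (is_derive_const ((eta / 2) ^ 2)).
  - intros t _ Ht; specialize (Hmargin t ltac:(lra)).
    assert (Hsq := pow2_ge_0 (x t + 2 * PI * IZR k - xi (y t))); nra.
  - rewrite <- (pow2_abs (x 0 + _ - _)).
    assert (Hp := Rabs_pos (x 0 + 2 * PI * IZR k - xi (y 0))); nra. }
intros t Ht; replace (- rate (eta / 2) * t) with (- rate (eta / 2) * (t - 0)) by ring.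
apply (exp_decay (fun t => (x t + 2 * PI * IZR k - xi (y t)) ^ 2) dE); trivial.
intros u Hu; apply Hmargin; specialize (Hin u ltac:(lra)); lra.
Qed.

Lemma distance_tends_0 x y (k : Z) eps : sol x y -> 0 < eps ->
  Rabs (x 0 + 2 * PI * IZR k - xi (y 0)) < eta / 2 ->
  exists t0, 0 <= t0 /\
    forall t, t0 <= t -> Rabs (x t + 2 * PI * IZR k - xi (y t)) < eps.
Proof.
intros H Heps H0; set (ro := rate (eta / 2)).
assert (Hro : 0 < ro) by (apply rate_pos; lra).
assert (He2 : 0 < eps ^ 2) by (apply pow_lt; assumption).
(* From exp(u) >= 1 + u, d^2 <= eta^2 / (1 + ro t), which is below eps^2 as soon as ro t >= eta^2 /
   eps^2. *)
exists (eta ^ 2 / (eps ^ 2 * ro)).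
assert (Ht0 : 0 < eta ^ 2 / (eps ^ 2 * ro)).
{ apply Rdiv_lt_0_compat; [apply pow_lt; lra|].
  now apply Rmult_lt_0_compat. }
split; [lra|]; intros t Ht.
assert (Hd := distance_decay x y k H H0 t ltac:(lra)); fold ro in Hd.
assert (Hd0 : (x 0 + 2 * PI * IZR k - xi (y 0)) ^ 2 <= eta ^ 2).
{ rewrite <- pow2_abs.
  assert (Hp := Rabs_pos (x 0 + 2 * PI * IZR k - xi (y 0))); nra. }
replace (- ro * t) with (- (ro * t)) in Hd by ring; rewrite exp_Ropp in Hd.
assert (Hexp : 1 + ro * t <= exp (ro * t)) by apply exp_ineq1_le.
assert (Hrt : eta ^ 2 <= eps ^ 2 * (ro * t)).
{ replace (eta ^ 2) with (eps ^ 2 * (ro * (eta ^ 2 / (eps ^ 2 * ro))))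
    by (field; lra).
  apply Rmult_le_compat_l; [lra|]; apply Rmult_le_compat_l; lra. }
assert (Hep := exp_pos (ro * t)).
apply (Rmult_le_compat_r (exp (ro * t))) in Hd; [|lra].
rewrite (Rmult_assoc _ (/ _)), Rinv_l, Rmult_1_r in Hd by lra.
rewrite <- (Rabs_pos_eq eps) by lra; apply Rsqr_lt_abs_0.
rewrite !Rsqr_pow2; apply (Rmult_lt_reg_r (exp (ro * t))); [assumption|].
assert (eps ^ 2 * (1 + ro * t) <= eps ^ 2 * exp (ro * t))
  by (apply Rmult_le_compat_l; lra).
lra.
Qed.

Lemma on_graph_stable g : on_graph g -> stable_orbit F g.
Proof.
intros Hg; assert (Hsl := slope_nonneg); split.
- intros eps Heps; exists (Rmin eps (eta / 2) / (1 + slope)); split.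
  { apply Rdiv_lt_0_compat; [apply Rmin_pos|]; lra. }
  intros z Hz Hn t Ht; destruct (distance_of_near g _ _ Hg Hn) as [j Hj].
  replace ((1 + slope) * (Rmin eps (eta / 2) / (1 + slope)))
    with (Rmin eps (eta / 2)) in Hj by (field; lra).
  assert (H1 := Rmin_l eps (eta / 2)); assert (H2 := Rmin_r eps (eta / 2)).
  assert (Hd := distance_decay (fx z) (fy z) j Hz
    (Rlt_le_trans _ _ _ Hj H2) t Ht); unfold fx, fy in Hd.
  apply (near_of_distance g eps (z t) j Hg).
  apply Rle_lt_trans with (2 := Rlt_le_trans _ _ _ Hj H1).
  apply Rsqr_le_abs_0; rewrite !Rsqr_pow2; apply Rle_trans with (1 := Hd).
  rewrite <- (Rmult_1_r ((fst (z 0) + _ - _) ^ 2)) at 2.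
  apply Rmult_le_compat_l; [apply pow2_ge_0|].
  rewrite <- exp_0; apply exp_nondecreasing.
  assert (Hro := rate_pos (eta / 2) ltac:(lra)); nra.
- exists (eta / 2 / (1 + slope)); split; [apply Rdiv_lt_0_compat; lra|].
  intros z Hz Hn eps Heps; destruct (distance_of_near g _ _ Hg Hn) as [j Hj].
  replace ((1 + slope) * (eta / 2 / (1 + slope))) with (eta / 2) in Hj
    by (field; lra).
  destruct (distance_tends_0 (fx z) (fy z) j eps Hz Heps Hj) as [t0 [_ Ht0]].
  exists t0; intros t Ht; now apply (near_of_distance g eps (z t) j Hg), Ht0.
Qed.

(** * Time reversal and instability *)

Definition reflect_point (p : R * R) := (PI - fst p, PI - snd p).
Definition reflect (z : R -> R * R) (t : R) := reflect_point (z (- t)).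

Lemma reflect_reflect z t : reflect (reflect z) t = z t.
Proof.
unfold reflect, reflect_point; rewrite Ropp_involutive; simpl.
rewrite (surjective_pairing (z t)) at 3; f_equal; ring.
Qed.

Lemma near_orbit_reflect g eps p :
  near_orbit g eps p -> near_orbit (reflect g) eps (reflect_point p).
Proof.
intros H; apply near_orbit_iff in H; destruct H as [u [k [l [H1 H2]]]].
apply near_orbit_iff; exists (- u), (- k)%Z, (- l)%Z.
unfold reflect; rewrite Ropp_involutive, !opp_IZR; simpl; split.
- replace (PI - fst p + 2 * PI * - IZR k - (PI - fst (g u))) with
    (- (fst p + 2 * PI * IZR k - fst (g u))) by ring.
  now rewrite Rabs_Ropp.
- replace (PI - snd p + 2 * PI * - IZR l - (PI - snd (g u))) with
    (- (snd p + 2 * PI * IZR l - snd (g u))) by ring.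
  now rewrite Rabs_Ropp.
Qed.

Lemma near_orbit_reflect_inv g eps p :
  near_orbit (reflect g) eps (reflect_point p) -> near_orbit g eps p.
Proof.
intros H; apply near_orbit_reflect, near_orbit_iff in H.
destruct H as [u H]; rewrite reflect_reflect in H; simpl in H.
apply near_orbit_iff; exists u.
replace (PI - (PI - fst p)) with (fst p) in H by ring.
now replace (PI - (PI - snd p)) with (snd p) in H by ring.
Qed.

(* A solution attracted by the stable orbit becomes, after the time-reversing
   reflection, a solution that leaves a fixed neighbourhood of the reflected
   orbit although it starts arbitrarily close to it. *)
Lemma reflect_unstable g : on_graph (reflect g) -> unstable_orbit F g.
Proof.
intros Hg Hst; assert (Hsl := slope_nonneg); assert (HP := PI_RGT_0).
destruct (Hst (eta / 4 / (1 + slope))) as [del [Hdel Hs]].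
{ apply Rdiv_lt_0_compat; lra. }
(* The distance eta / 4 lies inside the basin of radius eta / 2, but just outside the neighbourhood
   taken from stability once the factor 1 + slope is accounted for. *)
destruct (sol_exists (xi 0 + eta / 4) 0) as [x [y [H [Hx0 Hy0]]]].
assert (Hd0 : Rabs (x 0 + 2 * PI * IZR 0 - xi (y 0)) < eta / 2).
{ rewrite Hx0, Hy0.
  replace (xi 0 + eta / 4 + 2 * PI * 0 - xi 0) with (eta / 4) by ring.
  rewrite Rabs_pos_eq; lra. }
destruct (distance_tends_0 x y 0 del H Hdel Hd0) as [t0 [Ht0 Hnear]].
(* Time is shifted so that the reflected solution starts near [g] and reaches the reflection of the
   initial point (x 0, y 0) at time [t0]. *)
set (w := fun t => (x (t + t0), y (t + t0))).
assert (Hw : is_solution F (reflect w)).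
{ apply (sol_reflect (fun t => x (t + t0)) (fun t => y (t + t0))).
  now apply sol_shift. }
assert (Hn : near_orbit g (eta / 4 / (1 + slope)) (reflect w t0)).
{ apply Hs; trivial; apply near_orbit_reflect_inv.
  unfold reflect at 2; rewrite Ropp_0.
  replace (reflect_point (reflect_point (w 0))) with (w 0).
  - apply (near_of_distance _ _ _ 0%Z Hg), Hnear; simpl; lra.
  - unfold w, reflect_point; simpl; f_equal; ring. }
apply near_orbit_reflect in Hn.
destruct (distance_of_near _ _ _ Hg Hn) as [j Hj].
replace ((1 + slope) * (eta / 4 / (1 + slope))) with (eta / 4) in Hj
  by (field; lra).
unfold reflect, reflect_point, w in Hj; simpl in Hj.
replace (- t0 + t0) with 0 in Hj by ring; rewrite Hx0, Hy0 in Hj.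
replace (PI - (PI - 0)) with 0 in Hj by ring.
replace (PI - (PI - (xi 0 + eta / 4)) + 2 * PI * IZR j - xi 0) with
  (eta / 4 + 2 * PI * IZR j) in Hj by ring.
apply Rabs_def2 in Hj.
(* The inequality |eta / 4 + 2 pi j| < eta / 4 fails for j = 0, and eta <= pi / 2 leaves no room for
   another lift. *)
assert (Hj1 : -1 < IZR j < 0) by nra.
assert ((-1 < j < 0)%Z) by (split; apply lt_IZR; lra); lia.
Qed.

(** * Regions, winding numbers and classification of periodic orbits *)

Lemma region_D_of_cos p : 0 < cos (fst p) -> region_D p.
Proof.
intros Hc; destruct (cos_pos_strip _ Hc) as [k Hk].
destruct (angle_reduce (snd p)) as [l Hl].
exists (fst p + 2 * PI * IZR k, snd p + 2 * PI * IZR l); split.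
- now exists k, l.
- simpl; lra.
Qed.

Lemma region_Dc_of_cos p : cos (fst p) < 0 -> region_Dc p.
Proof.
intros Hc [q [[k [l [Hk _]]] [Hq _]]].
rewrite <- (proj2 (sin_cos_shift (fst p) k)), <- Hk in Hc.
assert (H := cos_ge_0 (fst q)); lra.
Qed.

Lemma winding_numbers_of_shift z T :
  fst (z T) = fst (z 0) ->
  snd (z T) - snd (z 0) = 2 * PI * e -> winding_numbers z T 0 1.
Proof.
intros Hx Hy; assert (HP := PI_RGT_0); split; unfold winding_number.
- rewrite Hx; simpl; unfold Rminus; rewrite Rplus_opp_r, Rabs_R0; ring.
- rewrite Hy; simpl; destruct he as [-> | ->].
  + rewrite Rabs_pos_eq; lra.
  + rewrite Rabs_left; lra.
Qed.

Lemma on_graph_least_period z T : on_graph z -> periodic_orbit F z T ->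
  forall t, fst (z (t + T)) = fst (z t) /\ snd (z (t + T)) = snd (z t) + 2 * PI * e.
Proof.
intros [Hz [k Hk]] [_ [Hp Hmin]].
destruct (on_graph_period (fx z) (fy z) k Hz Hk) as [T0 [Hp0 [Hmin0 Hsh]]].
replace T with T0; [exact Hsh|].
apply Rle_antisym; [now apply Hmin0|now apply Hmin].
Qed.

Lemma periodic_orbit_reflect z T :
  periodic_orbit F z T -> periodic_orbit F (reflect z) T.
Proof.
intros [Hz [Hp Hmin]]; split; [|split].
- now apply (sol_reflect (fx z) (fy z)).
- now apply (per_reflect (fx z) (fy z)).
- intros T' [HT' Hp']; apply Hmin; split; [assumption|].
  assert (H := per_reflect (fx (reflect z)) (fy (reflect z)) T' (conj HT' Hp')).
  destruct H as [_ H]; intros t; destruct (H t) as [j [l [H1 H2]]].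
  exists j, l; rewrite <- (reflect_reflect z t), <- (reflect_reflect z (t + T')).
  now split.
Qed.

Lemma periodic_orbit_pos z T : periodic_orbit F z T ->
  (forall t, 0 < cos (fst (z t))) ->
  winding_numbers z T 0 1 /\ orbit_in region_D z /\ stable_orbit F z.
Proof.
intros Hz Hc.
assert (Hg : on_graph z).
{ split; [apply Hz|]; now apply (per_on_graph (fx z) (fy z) T); try apply Hz. }
split; [|split].
- destruct (on_graph_least_period z T Hg Hz 0) as [Hx Hy].
  rewrite Rplus_0_l in Hx, Hy; apply winding_numbers_of_shift; lra.
- intros t; apply region_D_of_cos, Hc.
- now apply on_graph_stable.
Qed.

Lemma periodic_orbit_neg z T : periodic_orbit F z T ->
  (forall t, cos (fst (z t)) < 0) ->
  winding_numbers z T 0 1 /\ orbit_in region_Dc z /\ unstable_orbit F z.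
Proof.
intros Hz Hc; assert (Hr := periodic_orbit_reflect z T Hz).
assert (Hg : on_graph (reflect z)).
{ split; [apply Hr|].
  apply (per_on_graph (fx (reflect z)) (fy (reflect z)) T); try apply Hr.
  intros t; unfold fx, reflect, reflect_point; simpl.
  rewrite Rtrigo_facts.cos_pi_minus; specialize (Hc (- t)); lra. }
split; [|split].
(* At time - T the reflected orbit is the reflection of z T, and one period later that of z 0. *)
- destruct (on_graph_least_period _ T Hg Hr (- T)) as [Hx Hy].
  unfold reflect, reflect_point in Hx, Hy; simpl in Hx, Hy.
  rewrite Rplus_opp_l, Ropp_0, Ropp_involutive in Hx, Hy.
  apply winding_numbers_of_shift; lra.
- intros t; apply region_Dc_of_cos, Hc.
- now apply reflect_unstable.
Qed.

Lemma periodic_orbit_on_graph z : on_graph z -> exists T, periodic_orbit F z T.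
Proof.
intros [Hz [k Hk]].
destruct (on_graph_period (fx z) (fy z) k Hz Hk) as [T [Hp [Hmin _]]].
now exists T.
Qed.

End System.

(** * The thresholds on K and the conclusion *)

Lemma K3_upper_bound (a r K nux : R) :
  1 < (1 + r) * a -> K3_upper a r nux <= K -> nux <= K * ((1 + r) * a - 1).
Proof.
intros Ha H; unfold K3_upper in H; apply Rle_div_l in H; lra.
Qed.

(* An equilibrium would need |sin x| <= 1 and |sin y| <= 1. Above K3_upper the
   first bound follows from the second, so below K4 the second one fails. *)
Lemma no_equilibrium (a r s K nux nuy : R) :
  0 < a -> 0 < r -> 0 < s ->
  nux <= K * ((1 + r) * a - 1) -> K < K4 a r s nux nuy ->
  K * (r + s + r * s) < Rabs (nux - (1 + r) * nuy).
Proof.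
intros Ha Hr Hs Hlow Hup; unfold K4 in Hup.
set (D := r + s + r * s) in *.
assert (HD : 0 < D) by (unfold D; nra).
apply Rnot_le_lt; intros Hle.
assert (H2 : Rabs (nux - (1 + r) * nuy) / D <= K) by (apply Rle_div_l; lra).
assert (H1 : ((1 + s) * nux - nuy) / (a * D) <= K).
{ apply Rle_div_l; [nra|].
  apply Rabs_le_between in Hle.
  (* After multiplication by 1 + r the numerator is D nux + (nux - (1 + r) nuy), at most D K ((1 +
     r) a - 1) + K D = (1 + r) K a D. *)
  apply (Rmult_le_reg_l (1 + r)); [lra|].
  assert (HD1 : (1 + r) * ((1 + s) * nux - nuy) = D * nux + (nux - (1 + r) * nuy))
    by (unfold D; ring).
  rewrite HD1; nra. }
assert (H := Rmax_lub _ _ _ H1 H2); lra.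
Qed.

Theorem proposition1 (a r s K nux nuy : R)
  (ha : 0 < a) (hr : 0 < r) (hs : 0 < s) (hK : 0 < K)
  (hnux : 0 < nux) (hnu : Rabs nuy <= Rabs nux)
  (hK3 : 1 < (1 + r) * a)
  (hlow : K3_upper a r nux <= K) (hup : K < K4 a r s nux nuy) :
  (exists (z : R -> R * R) (T : R),
     periodic_orbit (vector_field a r s K nux nuy) z T /\
     orbit_in region_D z /\
     stable_orbit (vector_field a r s K nux nuy) z /\
     winding_numbers z T 0 1) /\
  (exists (z : R -> R * R) (T : R),
     periodic_orbit (vector_field a r s K nux nuy) z T /\
     orbit_in region_Dc z /\
     unstable_orbit (vector_field a r s K nux nuy) z /\
     winding_numbers z T 0 1) /\
  (forall (z : R -> R * R) (T : R),
     periodic_orbit (vector_field a r s K nux nuy) z T ->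
     winding_numbers z T 0 1 /\
     ((orbit_in region_D z /\
       stable_orbit (vector_field a r s K nux nuy) z) \/
      (orbit_in region_Dc z /\
       unstable_orbit (vector_field a r s K nux nuy) z))).
Proof.
assert (hlow' := K3_upper_bound a r K nux hK3 hlow).
assert (Heq := no_equilibrium a r s K nux nuy ha hr hs hlow' hup).
(* The amplitude K (r + s + r s) of the sine in Q is smaller than the modulus of its mean (1 + r)
   nuy - nux: [e] is the sign of that mean and [m] the gap. *)
assert (Hsign : exists e m, (e = 1 \/ e = -1) /\ 0 < m /\
  forall y, m <= e * Q r s K nux nuy y).
{ assert (HKD : 0 < K * (r + s + r * s)) by (apply Rmult_lt_0_compat; nra).
  assert (Hsin : forall y,
    Rabs (K * (r + s + r * s) * sin y) <= K * (r + s + r * s)).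
  { intros y; rewrite Rabs_mult, (Rabs_pos_eq (K * (r + s + r * s))) by lra.
    assert (Hb := Rmult_le_compat_l _ _ _ (Rlt_le _ _ HKD)
      (Rabs_le _ 1 (SIN_bound y))); lra. }
  destruct (Rle_lt_dec 0 ((1 + r) * nuy - nux)) as [Hge|Hlt].
  - exists 1, ((1 + r) * nuy - nux - K * (r + s + r * s)).
    rewrite Rabs_minus_sym, Rabs_pos_eq in Heq by lra.
    split; [now left|split; [lra|]]; intros y; unfold Q.
    specialize (Hsin y); apply Rabs_le_between in Hsin; lra.
  - exists (-1), (nux - (1 + r) * nuy - K * (r + s + r * s)).
    rewrite Rabs_pos_eq in Heq by lra.
    split; [now right|split; [lra|]]; intros y; unfold Q.
    specialize (Hsin y); apply Rabs_le_between in Hsin; lra. }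
destruct Hsign as [e [m [he [hm hQm]]]].
assert (hQ : forall y, Q r s K nux nuy y <> 0).
{ intros y H0; specialize (hQm y); rewrite H0 in hQm; lra. }
destruct (graph_exists a r s K nux nuy ha hr hs hK hnux hlow' hQ e m he hm hQm)
  as [xi [eta [c [[heta hc] [hxi [hxiper [hxistrip [hxiY [x [y [Hsol Hg]]]]]]]]]]].
assert (Hpos : forall z T, periodic_orbit (vector_field a r s K nux nuy) z T ->
  (forall t, 0 < cos (fst (z t))) -> winding_numbers z T 0 1 /\
  orbit_in region_D z /\ stable_orbit (vector_field a r s K nux nuy) z)
  by (intros z T; apply (periodic_orbit_pos a r s K nux nuy)
        with e m xi eta c; assumption).
assert (Hneg : forall z T, periodic_orbit (vector_field a r s K nux nuy) z T ->
  (forall t, cos (fst (z t)) < 0) -> winding_numbers z T 0 1 /\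
  orbit_in region_Dc z /\ unstable_orbit (vector_field a r s K nux nuy) z)
  by (intros z T; apply (periodic_orbit_neg a r s K nux nuy)
        with e m xi eta c; assumption).
set (z0 := fun t => (x t, y t)).
assert (Hz0 : on_graph a r s K nux nuy xi z0).
{ split; [exact Hsol|]; exists 0%Z; intros t; simpl; rewrite Hg; ring. }
assert (Hex : exists T, periodic_orbit (vector_field a r s K nux nuy) z0 T)
  by (apply (periodic_orbit_on_graph a r s K nux nuy) with e m xi eta c; assumption).
destruct Hex as [T HT].
assert (Hcos : forall t, 0 < cos (fst (z0 t))).
{ intros t; simpl; rewrite Hg; specialize (hxistrip (y t)); apply cos_gt_0; lra. }
split; [|split].
- exists z0, T; destruct (Hpos z0 T HT Hcos) as [H1 [H2 H3]].
  exact (conj HT (conj H2 (conj H3 H1))).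
- exists (reflect z0), T.
  assert (HT' : periodic_orbit (vector_field a r s K nux nuy) (reflect z0) T)
    by (apply periodic_orbit_reflect; assumption).
  destruct (Hneg (reflect z0) T HT') as [H1 [H2 H3]];
    [|exact (conj HT' (conj H2 (conj H3 H1)))].
  intros t; simpl; rewrite Rtrigo_facts.cos_pi_minus; specialize (Hcos (- t)).
  simpl in Hcos; lra.
- intros z T' Hz.
  assert (Hsgn : (forall t, 0 < cos (fst (z t))) \/ (forall t, cos (fst (z t)) < 0)).
  { destruct Hz as [Hz [Hp _]].
    apply (cos_sign_per a r s K nux nuy hK hnux hlow' hQ
      (fun t => fst (z t)) (fun t => snd (z t)) T' Hz Hp). }
  destruct Hsgn as [Hc|Hc].
  + destruct (Hpos z T' Hz Hc) as [H1 H2]; split; [assumption|now left].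
  + destruct (Hneg z T' Hz Hc) as [H1 H2]; split; [assumption|now right].
Qed.
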